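(* Let $N\in\mathbb N$ and, for $j=1,2,3,4$, let $U_j=e^{\mathcal L_j}$ with $\mathcal L_j=i\sum_{\alpha=1}^{N^2}x^j_\alpha\theta_\alpha$, where $x^j_\alpha=-i\,\mathrm{Tr}(\theta_\alpha\mathcal L_j)$ is real, so that $\|\mathcal L_j\|\le\|\mathcal L_j\|_{H-S}=|x^j|$. For $\delta\in[0,1]$ let $U_j(\delta)=e^{\delta\mathcal L_j}$, $U_p(\delta)=U_1(\delta)U_2(\delta)U_3^\dagger(\delta)U_4^\dagger(\delta)$, $U_p=U_p(1)$, and write $$M_1=\mathcal L_1U_1U_2U_3^\dagger U_4^\dagger,\quad M_2=U_1\mathcal L_2U_2U_3^\dagger U_4^\dagger,\quad M_3=U_1U_2\mathcal L_3U_3^\dagger U_4^\dagger,\quad M_4=U_1U_2U_3^\dagger\mathcal L_4U_4^\dagger,$$ all $U_j$ here being evaluated at $\delta$. Then: (1) (Representation.) By the Fundamental Theorem of Calculus, $$U_p-1=\int_0^1\big[M_1(\delta)+M_2(\delta)-M_3(\delta)-M_4(\delta)\big]d\delta$$ $$=\int_0^1\Big\{\mathcal L_1+\int_0^\delta M_1'(\hat\delta)d\hat\delta\Big\}d\delta+\int_0^1\Big\{\mathcal L_2+\int_0^\delta M_2'(\hat\delta)d\hat\delta\Big\}d\delta-\int_0^1\Big\{\mathcal L_3+\int_0^\delta M_3'(\hat\delta)d\hat\delta\Big\}d\delta-\int_0^1\Big\{\mathcal L_4+\int_0^\delta M_4'(\hat\delta)d\hat\delta\Big\}d\delta,$$ where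 $M_j'$ is the derivative of $M_j$, expanded by the product rule (e.g. $M_1'=\mathcal L_1\mathcal L_1U_1U_2U_3^\dagger U_4^\dagger+\dots$, $M_2'=\mathcal L_1U_1\mathcal L_2U_2U_3^\dagger U_4^\dagger+\dots$). (2) (One plaquette.) For a single plaquette action $A_p(U_p)=2\,\mathrm{Re}\,\mathrm{Tr}(1-U_p)$, the second representation in (1) holds without the isolated $\mathcal L_j$ terms, which give an imaginary trace, and there is the global quadratic upper bound $$A_p=\|U_p-1\|^2_{H-S}=|2\,\mathrm{Re}\,\mathrm{Tr}(U_p-1)|\le C^2\sum_{1\le j\le4}|x^j|^2,\qquad C=2\sqrt N,\quad C^2=4N.$$ In particular, for the physical parametrization $U_b=\exp[igaA_b^u]$ and the scaled field parametrization $U_b=\exp[iga^{(4-d)/2}A_b]$ one has, respectively, $$\frac{a^{d-4}}{g^2}A_p\le C^2a^{d-2}\sum_b|A_b^u|^2\qquad\text{and}\qquad\frac{a^{d-4}}{g^2}A_p\le C^2\sum_b|A_b|^2,$$ where $\sum_b$ runs over the bonds of the plaquette. Hence the plaquette energy $\frac{a^{d-4}}{g^2}A_p$ is regular in $g^2$, for all $g^2\ge0$, and has a quadratic growth bound in the fields. When there are only one, two or three retained bond variables in the plaquette (the others being set to the identity), the sum over $j$ has, respectively, only one, two or three terms and the numerical factor $4$ in $C^2=4N$ is replaced by $1$, $2$ and $3$, respectively. (3) (Total action.) For the total action with free or periodic boundary conditions, the global quadratic upper bound $$\sum_pA_p\le2(d-1)C^2\sum_b|x^b|^2=2(d-1)C^2\sum_b|\lambda_b|^2$$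 holds, where, whenever gauge fixing is applied, the sum over $b$ runs over all $\Lambda_r$ retained lattice bonds. (4) (Plaquette fields.) For the unscaled and scaled plaquette fields $$\mathrm{Tr}\,\mathcal F^u_p=\frac1{a^2g}\,\mathrm{Im}\,\mathrm{Tr}(U_p-1),\qquad \mathrm{Tr}\,\mathcal F_p=a^{d/2}\,\mathrm{Tr}\,\mathcal F^u_p,$$ one also has the representation of (1), and the isolated $\mathcal L_j$ terms alone are, respectively, $$a^{-d/2}\,\mathrm{Tr}(A_1^u+A_2^u-A_3^u-A_4^u)=a^{-d/2}\,\mathrm{Tr}(\partial_\mu A^u_\nu-\partial_\nu A^u_\mu)\qquad\text{and}\qquad\mathrm{Tr}(\partial_\mu A_\nu-\partial_\nu A_\mu).$$ The coefficients in the integral terms are proportional to $g$, so that the plaquette fields are also regular in $g$, for $g^2\ge0$.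
   Context: $\|M\|_{H-S}=[\mathrm{Tr}(M^\dagger M)]^{1/2}$ is the Hilbert-Schmidt norm and $\|\cdot\|$ the operator norm. $\theta_1,\dots,\theta_{N^2}$ is a basis of the self-adjoint $N\times N$ matrices with $\mathrm{Tr}\,\theta_\alpha\theta_\beta=\delta_{\alpha\beta}$; $|x|^2=\sum_\alpha|x_\alpha|^2$, and for self-adjoint $A=\sum_\alpha A^\alpha\theta_\alpha$, $|A|^2=\sum_\alpha|A^\alpha|^2$. Parameters: $d\in\{2,3,4\}$, $a\in(0,1]$, $g>0$; the gauge group is $\mathrm U(N)$. Lattice: $\Lambda\subset a\mathbb Z^d$ is the hypercubic lattice with $L$ (even) sites on a side, coordinate directions $0,1,\dots,d-1$, $e^\mu$ the unit vector of direction $\mu$. Free bonds are $[x,x+ae^\mu]$ with both ends in $\Lambda$; for periodic boundary conditions one adds, in each direction and on each lattice line, a bond from the last site to the first one. To each bond $b$ is assigned $U_b\in\mathrm U(N)$. A plaquette $p=p_{\mu\nu}(x)$, $\mu<\nu$, has bonds $b_1=[x,x+ae^\mu]$, $b_2=[x+ae^\mu,x+ae^\mu+ae^\nu]$, $b_3=[x+ae^\nu,x+ae^\nu+ae^\mu]$, $b_4=[x,x+ae^\nu]$, and $U_p=U_{b_1}U_{b_2}U_{b_3}^\dagger U_{b_4}^\dagger$, $U_j=U_{b_j}$. The sum $\sum_p$ is over all plaquettes formed from the bonds of the lattice with the given boundary conditions. Gauge fixing means setting to the identity the bond variables of a maximal tree of bonds of $\Lambda$; the remaining bonds are called retained, and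 $\Lambda_r$ is their number. For each bond, $U_b=\exp(i\sum_\alpha x^b_\alpha\theta_\alpha)$, and $\lambda_b=(\lambda_{b,1},\dots,\lambda_{b,N})\in(-\pi,\pi]^N$ are the angular eigenvalues of $U_b$ (i.e. $e^{i\lambda_{b,k}}$ are its eigenvalues); $\sum_\alpha x^b_\alpha\theta_\alpha$ is chosen to be the self-adjoint matrix with eigenvalues $\lambda_{b,k}$, so that $|x^b|^2=|\lambda_b|^2$. Fields: $A^u_b$ (unscaled, physical) is defined by $U_b=\exp[igaA^u_b]$ and the scaled field is $A_b=a^{(d-2)/2}A^u_b$; $A_j^u=A^u_{b_j}$, and $A^u_\mu(x)=A^u_{[x,x+ae^\mu]}$, and similarly for $A$. In (4), $\partial_\mu A_\nu(x)$ stands for the lattice difference $A_\nu(x+ae^\mu)-A_\nu(x)$, so that $A_1+A_2-A_3-A_4=\partial_\mu A_\nu-\partial_\nu A_\mu$, and likewise for $A^u$.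
   Formalization: In (4) the isolated terms of Tr F^u_p are proved as a^{-1}Tr(A^u_1+A^u_2-A^u_3-A^u_4), equal to a^{-d/2}Tr(A_1+A_2-A_3-A_4) with scaled A; the printed a^{-d/2} with A^u fails for d≠2, a<1. In (2) ''regular in g^2'' means continuous in g^2≥0 and a power series in g. *)

(* Defs.v *)
From HB Require Import structures.
From mathcomp Require Import all_boot all_order all_algebra.
From mathcomp Require Import all_classical all_reals all_analysis.
From mathcomp Require Import complex.
Set Implicit Arguments.
Unset Strict Implicit.
Unset Printing Implicit Defensive.
Import Order.TTheory GRing.Theory Num.Theory.
Import numFieldNormedType.Exports.

Local Open Scope sesquilinear_scope.
Local Open Scope complex_scope.
Local Open Scope ring_scope.

(** * Calculus for complex matrices

    [R[i]] carries no canonical structure of normed module over [R], so limits,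
    derivatives and integrals are taken on the real and imaginary parts of the
    entries. *)

Definition clim {R : realType} (u : nat -> R[i]) : R[i] :=
  lim ((fun n => complex.Re (u n)) @ \oo)%classic +i* lim ((fun n => complex.Im (u n)) @ \oo)%classic.

Definition expmx {R : realType} {n : nat} (A : 'M[R[i]]_n) : 'M[R[i]]_n :=
  \matrix_(i, j) clim (fun m => (\sum_(k < m) (k`!%:R)^-1 *: A ^+ k) i j).

Definition is_derive_mx {R : realType} {m n : nat} (F : R -> 'M[R[i]]_(m, n))
    (t : R) (dF : 'M[R[i]]_(m, n)) : Prop :=
  forall i j,
    is_derive t (1 : R) (fun s => complex.Re (F s i j)) (complex.Re (dF i j)) /\
    is_derive t (1 : R) (fun s => complex.Im (F s i j)) (complex.Im (dF i j)).

Definition integrable_mx {R : realType} {m n : nat} (F : R -> 'M[R[i]]_(m, n))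
    (a b : R) : Prop :=
  forall i j,
    lebesgue_measure.-integrable `[a, b]%classic
      (EFin \o (fun s : R => complex.Re (F s i j))) /\
    lebesgue_measure.-integrable `[a, b]%classic
      (EFin \o (fun s : R => complex.Im (F s i j))).

Definition integral_mx {R : realType} {m n : nat} (F : R -> 'M[R[i]]_(m, n))
    (a b : R) : 'M[R[i]]_(m, n) :=
  \matrix_(i, j)
    ((\int[lebesgue_measure]_(s in `[a, b]%classic) complex.Re (F s i j)) +i*
     (\int[lebesgue_measure]_(s in `[a, b]%classic) complex.Im (F s i j))).

(** * Norms *)

Definition norm_HS {R : realType} {m n : nat} (M : 'M[R[i]]_(m, n)) : R :=
  Num.sqrt (complex.Re (\tr (M^t* *m M))).

(* On a column vector [norm_HS] is the Euclidean norm. *)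
Definition norm_op {R : realType} {m n : nat} (M : 'M[R[i]]_(m, n)) : R :=
  sup [set norm_HS (M *m v) | v in [set v : 'cV[R[i]]_n | norm_HS v <= 1]]%classic.

(** * Coordinates in the Lie algebra of U(N) *)

Definition selfadjoint_basis {R : realType} {N : nat}
    (theta : 'I_(N ^ 2) -> 'M[R[i]]_N) : Prop :=
  [/\ forall alpha, theta alpha \is hermsymmx,
      forall alpha beta, \tr (theta alpha *m theta beta) = (alpha == beta)%:R
    & forall A : 'M[R[i]]_N, A \is hermsymmx ->
        exists x : 'I_(N ^ 2) -> R, A = \sum_alpha (x alpha)%:C *: theta alpha].

Definition selfadj {R : realType} {N : nat} (theta : 'I_(N ^ 2) -> 'M[R[i]]_N)
    (x : 'I_(N ^ 2) -> R) : 'M[R[i]]_N :=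
  \sum_alpha (x alpha)%:C *: theta alpha.

(* [ilie theta c x] is the exponent [i c \sum_alpha x_alpha theta_alpha]. *)
Definition ilie {R : realType} {N : nat} (theta : 'I_(N ^ 2) -> 'M[R[i]]_N)
    (c : R) (x : 'I_(N ^ 2) -> R) : 'M[R[i]]_N :=
  ('i%C * c%:C) *: selfadj theta x.

Definition sqnorm {R : realType} {n : nat} (x : 'I_n -> R) : R :=
  \sum_alpha `|x alpha| ^+ 2.

(* [U] has angular eigenvalues [lam], counted with multiplicity, and
   [\sum_alpha x_alpha theta_alpha] is the corresponding choice of logarithm. *)
Definition angular_coordinates {R : realType} {N : nat}
    (theta : 'I_(N ^ 2) -> 'M[R[i]]_N) (U : 'M[R[i]]_N) (lam : 'I_N -> R)
    (x : 'I_(N ^ 2) -> R) : Prop :=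
  [/\ forall k, - pi < lam k <= pi,
      char_poly U = \prod_k ('X - (cos (lam k) +i* sin (lam k))%:P),
      char_poly (selfadj theta x) = \prod_k ('X - ((lam k)%:C)%:P)
    & U = expmx (ilie theta 1 x)].

(** * One plaquette

    The four bonds of a plaquette are indexed by ['I_4]. *)

Definition b1 : 'I_4 := @Ordinal 4 0 isT.
Definition b2 : 'I_4 := @Ordinal 4 1 isT.
Definition b3 : 'I_4 := @Ordinal 4 2 isT.
Definition b4 : 'I_4 := @Ordinal 4 3 isT.

Definition plaq {R : realType} {N : nat} (U : 'I_4 -> 'M[R[i]]_N) :
    'M[R[i]]_N :=
  U b1 *m U b2 *m (U b3)^t* *m (U b4)^t*.

Definition action {R : realType} {N : nat} (Up : 'M[R[i]]_N) : R :=
  2 * complex.Re (\tr (1%:M - Up)).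

Definition plaqM {R : realType} {N : nat} (j : 'I_4)
    (L U : 'I_4 -> 'M[R[i]]_N) : 'M[R[i]]_N :=
  let U1 := U b1 in let U2 := U b2 in
  let V3 := (U b3)^t* in let V4 := (U b4)^t* in
  nth 0 [:: L b1 *m U1 *m U2 *m V3 *m V4;
            U1 *m L b2 *m U2 *m V3 *m V4;
            U1 *m U2 *m L b3 *m V3 *m V4;
            U1 *m U2 *m V3 *m L b4 *m V4] j.

(* Product-rule expansion of the derivative of [plaqM j L (U delta)] along
   [U_k(delta) = exp(delta L_k)], the [L_k] being anti-self-adjoint; the
   derivative of [U_k^t*] is [- L_k U_k^t*]. *)
Definition plaqdM {R : realType} {N : nat} (j : 'I_4)
    (L U : 'I_4 -> 'M[R[i]]_N) : 'M[R[i]]_N :=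
  let L1 := L b1 in let L2 := L b2 in let L3 := L b3 in let L4 := L b4 in
  let U1 := U b1 in let U2 := U b2 in
  let V3 := (U b3)^t* in let V4 := (U b4)^t* in
  nth 0
    [:: L1 *m L1 *m U1 *m U2 *m V3 *m V4 + L1 *m U1 *m L2 *m U2 *m V3 *m V4
        - L1 *m U1 *m U2 *m L3 *m V3 *m V4 - L1 *m U1 *m U2 *m V3 *m L4 *m V4;
        L1 *m U1 *m L2 *m U2 *m V3 *m V4 + U1 *m L2 *m L2 *m U2 *m V3 *m V4
        - U1 *m L2 *m U2 *m L3 *m V3 *m V4 - U1 *m L2 *m U2 *m V3 *m L4 *m V4;
        L1 *m U1 *m U2 *m L3 *m V3 *m V4 + U1 *m L2 *m U2 *m L3 *m V3 *m V4
        - U1 *m U2 *m L3 *m L3 *m V3 *m V4 - U1 *m U2 *m L3 *m V3 *m L4 *m V4;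
        L1 *m U1 *m U2 *m V3 *m L4 *m V4 + U1 *m L2 *m U2 *m V3 *m L4 *m V4
        - U1 *m U2 *m L3 *m V3 *m L4 *m V4 - U1 *m U2 *m V3 *m L4 *m L4 *m V4] j.

Definition flow {R : realType} {N : nat} (L : 'I_4 -> 'M[R[i]]_N) (delta : R) :
    'I_4 -> 'M[R[i]]_N :=
  fun j => expmx (delta%:C *: L j).

(* [U_p - 1] as the integral of [M_1 + M_2 - M_3 - M_4]. *)
Definition rep1 {R : realType} {N : nat} (L : 'I_4 -> 'M[R[i]]_N) : 'M[R[i]]_N :=
  let M j delta := plaqM j L (flow L delta) in
  integral_mx (fun delta => M b1 delta + M b2 delta - M b3 delta - M b4 delta) 0 1.

(* The same, each [M_j] being in turn written as [L_j + \int_0^delta M_j']. *)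
Definition rep2 {R : realType} {N : nat} (L : 'I_4 -> 'M[R[i]]_N) : 'M[R[i]]_N :=
  let dM j delta := plaqdM j L (flow L delta) in
  let K j := integral_mx (fun delta => L j + integral_mx (dM j) 0 delta) 0 1 in
  K b1 + K b2 - K b3 - K b4.

(* [rep2 L] without the isolated [L_j] terms, and with the prefactors [L_k] of
   the [M_j'] replaced by [B_k], the [U_k] being still generated by [L]. *)
Definition remainder {R : realType} {N : nat} (B L : 'I_4 -> 'M[R[i]]_N) :
    'M[R[i]]_N :=
  let dM j delta := plaqdM j B (flow L delta) in
  let K j := integral_mx (fun delta => integral_mx (dM j) 0 delta) 0 1 in
  K b1 + K b2 - K b3 - K b4.

Definition circ {R : realType} {N : nat} (B : 'I_4 -> 'M[R[i]]_N) : 'M[R[i]]_N :=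
  B b1 + B b2 - B b3 - B b4.

Definition retain {R : realType} {N : nat} {I : finType} (S : {set I})
    (U : I -> 'M[R[i]]_N) : I -> 'M[R[i]]_N :=
  fun b => if b \in S then U b else 1%:M.

Definition C_plaq (R : realType) (N : nat) : R := 2 * Num.sqrt N%:R.

Definition energy {R : realType} {N : nat} (d : nat) (a g : R)
    (Up : 'M[R[i]]_N) : R :=
  a `^ (d%:R - 4) / g ^+ 2 * action Up.

(** * Regularity in the coupling

    A function of [g >= 0] is regular if it is the sum of a power series in [g]
    converging for all [g >= 0]. *)
Definition regular_in_g {R : realType} (F : R -> R) : Prop :=
  exists c : R^nat, forall g, 0 <= g -> (pseries c g @ \oo --> F g)%classic.

(* [E], a function of [s = g^2 >= 0], is regular up to and including [s = 0].
   An expansion at [s = 0] in integer powers of [s] cannot be required: a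
   plaquette energy has in general odd powers of [g]. *)
Definition regular_in_g2 {R : realType} (E : R -> R) : Prop :=
  ({within `[0, +oo[, continuous E})%classic /\ regular_in_g (fun g => E (g ^+ 2)).

(** * Lattice

    Sites are given by their coordinates in units of the lattice spacing. The
    bond [(x, mu)] is [[x, x + a e^mu]]; if [x] is a last site in direction [mu]
    it is the bond from that site to the first one, present only for periodic
    boundary conditions. *)

Inductive boundary := Free | Periodic.

Definition site (d L : nat) := {ffun 'I_d -> 'I_L}.
Definition bond (d L : nat) := (site d L * 'I_d)%type.

Definition shift {d L : nat} (x : site d L) (mu : 'I_d) : site d L :=
  [ffun nu => if nu == mu then ordS (x nu) else x nu].

Definition lattice_bonds {d L : nat} (bc : boundary) : {set bond d L} :=
  [set b : bond d L |
    if bc is Periodic then true else ((b.1 b.2).+1 < L)%N].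

(* The plaquette [p_{mu nu}(x)] is encoded by [(x, mu, nu)]. *)
Definition plaq_bond {d L : nat} (p : site d L * 'I_d * 'I_d) (j : 'I_4) :
    bond d L :=
  let: (x, mu, nu) := p in
  nth (x, mu) [:: (x, mu); (shift x mu, nu); (shift x nu, mu); (x, nu)] j.

Definition plaquettes {d L : nat} (bc : boundary) :
    {set site d L * 'I_d * 'I_d} :=
  [set p : site d L * 'I_d * 'I_d | (p.1.2 < p.2)%N &&
    [forall j, plaq_bond p j \in lattice_bonds bc]].

Definition joined {d L : nat} (T : {set bond d L}) : rel (site d L) :=
  connect (fun x y => [exists b in T,
    ((x, y) == (b.1, shift b.1 b.2)) || ((y, x) == (b.1, shift b.1 b.2))]).

(* A bond lies on a loop of [T] when the rest of [T] joins its two ends. *)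
Definition is_tree {d L : nat} (T : {set bond d L}) : bool :=
  [forall b in T, ~~ joined (T :\ b) b.1 (shift b.1 b.2)] &&
  [forall b in T, forall b' in T, joined T b.1 b'.1].

Definition maximal_tree {d L : nat} (bc : boundary) (T : {set bond d L}) : bool :=
  maxset (fun T' => (T' \subset lattice_bonds bc) && is_tree T') T.

(* Retained bonds: all bonds of the lattice without gauge fixing, the
   complement of a maximal tree with gauge fixing. *)
Definition retained_bonds {d L : nat} (bc : boundary) (S : {set bond d L}) : Prop :=
  S = lattice_bonds bc \/
  exists2 T, maximal_tree bc T & S = lattice_bonds bc :\: T.

(* Lattice difference [\partial_mu A_nu (x)]. *)
Definition ldiff {R : realType} {N d L : nat} (A : bond d L -> 'M[R[i]]_N)
    (mu nu : 'I_d) (x : site d L) : 'M[R[i]]_N :=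
  A (shift x mu, nu) - A (x, nu).

(** * Traces of the unscaled and scaled plaquette fields *)

Definition tr_Fu {R : realType} {N : nat} (a g : R) (Up : 'M[R[i]]_N) : R :=
  (a ^+ 2 * g)^-1 * complex.Im (\tr (Up - 1%:M)).

Definition tr_F {R : realType} {N : nat} (d : nat) (a g : R) (Up : 'M[R[i]]_N) : R :=
  a `^ (d%:R / 2) * tr_Fu a g Up.

(* Main.v *)
(* Along [U_j(t) = exp (t L_j)] the plaquette variable is a product of matrix
   exponentials whose entries are entire functions of [t]; the representations
   of [U_p - 1] are the fundamental theorem of calculus, and regularity in [g]
   is the convergence of the Taylor series after division by [g] or [g^2].
   For the quadratic bound, [2 Re Tr (1 - U)] is [|U - 1|^2] in the
   Hilbert-Schmidt norm when [U] is unitary, [U_p - 1] telescopes into four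
   terms of norms [|U_j - 1|], and [|exp L - 1| <= |L|]. On the lattice a bond
   lies in at most [2 (d - 1)] plaquettes. *)
Require Import Defs.
From HB Require Import structures.
From mathcomp Require Import all_boot all_order all_algebra.
From mathcomp Require Import all_classical all_reals all_analysis.
From mathcomp Require Import complex.
From mathcomp Require Import ring lra.
Set Implicit Arguments.
Unset Strict Implicit.
Unset Printing Implicit Defensive.
Import Order.TTheory GRing.Theory Num.Theory.
Import numFieldNormedType.Exports.
Local Open Scope classical_set_scope.
Local Open Scope sesquilinear_scope.
Local Open Scope complex_scope.
Local Open Scope ring_scope.

(** * Entire functions of a real variable *)

(** The coupling multiplies every exponent by a real factor, so $g$ is the time of the flow
    $e^{tL}$, and the dependence on $g$ is the dependence on $t$. One class of functions, [entire],
    closed under sums and products, then supplies the derivatives, the continuity that makes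
    integrands integrable, and the power series in $g$. Its costly closure property is the product,
    which rests on absolute convergence. Facts about the exponential are read off from its
    differential equation: $e^Le^{-L}=1$ because the derivative along the flow vanishes, and
    $|e^L-1|\le|L|$ from a second-order differential inequality for the trace, without diagonalising
    $L$. Dividing the action by $g^2$ requires a double zero at $g=0$; the quadratic bound itself
    provides it, so no Taylor coefficient is computed. In the constants, Cauchy-Schwarz over the
    telescoped terms produces the number of retained bonds of the plaquette; the further factor $N$
    of $C^2$ comes from $1\le N$. *)

Lemma cauchy_product_partial {R : realType} (u v : nat -> R) (n : nat) :
  \sum_(0 <= m < n) \sum_(i < m.+1) u i * v (m - i)%N =
  \sum_(i < n) u i * \sum_(0 <= j < n - i) v j.
Proof.
elim: n => [|n IH]; first by rewrite big_geq // big_ord0.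
rewrite big_nat_recr //= IH [RHS]big_ord_recr /= subSnn big_nat1.
rewrite [X in _ + X]big_ord_recr /= subnn addrA; congr (_ + _).
rewrite -big_split /=; apply: eq_bigr => i _.
by rewrite subSn ?big_nat_recr //= ?mulrDr // ltnW.
Qed.

(** The square $i,j<n$ minus the triangle $i+j<n$ contains only pairs with an index at least $n/2$
    (rounded down). The discrepancy is therefore at most $U_nV_n-U_{n/2}V_{n/2}$, with [U] and [V]
    the partial sums of absolute values, and this tends to $0$. *)
Lemma cvg_cauchy_product {R : realType} (u v : nat -> R) :
  cvgn [normed series u] -> cvgn [normed series v] ->
  (series (fun m => \sum_(i < m.+1) u i * v (m - i)%N) @ \oo -->
    limn (series u) * limn (series v))%classic.
Proof.
move=> cu cv.
pose C := series (fun m => \sum_(i < m.+1) u i * v (m - i)%N).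
pose U := [normed series u]; pose V := [normed series v].
have V_nd m n : (m <= n)%N -> V m <= V n.
  by move=> mn; apply: (@nondecreasing_series _ (fun k => `|v k|) xpredT 0%N).
have bound n : `|C n - series u n * series v n| <= U n * V n - U n./2 * V n./2.
  rewrite distrC /C /series /= cauchy_product_partial big_mkord mulr_suml -sumrB.
  have le1 : `|\sum_(i < n) (u i * (\sum_(0 <= k < n) v k) -
      u i * (\sum_(0 <= j < n - i) v j))| <=
      \sum_(i < n) `|u i| * (V n - V (n - i)%N).
    apply: le_trans (ler_norm_sum _ _ _) _; apply: ler_sum => i _.
    rewrite -mulrBr normrM ler_wpM2l //.
    rewrite /V /series /= (@big_cat_nat _ _ _ (n - i)) ?leq_subr //=.
    rewrite [X in _ <= X - _](@big_cat_nat _ _ _ (n - i)) ?leq_subr //=.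
    by rewrite [X in `|X|]addrAC subrr add0r [leRHS]addrAC subrr add0r ler_norm_sum.
  apply: le_trans le1 _.
  under eq_bigr do rewrite mulrBr.
  rewrite sumrB -mulr_suml [X in _ - X <= _](_ : _ = \sum_(i < n) `|u i| * V (n - i)%N) //.
  rewrite [U n]/series [U n./2]/series /= !big_mkord lerD2l lerN2 mulr_suml.
  have hn : (n./2 <= n)%N by rewrite -{2}[n]odd_double_half -addnn addnA leq_addl.
  rewrite (big_ord_widen n (fun i : nat => `|u i| * V n./2) hn).
  rewrite [leRHS](bigID (fun i : 'I_n => (i < n./2)%N)) /=.
  (* For $i<n/2$ one has $n-i\ge n/2$, hence $V_{n/2}\le V_{n-i}$; the rows with larger $i$ are
     dropped. *)
  apply: le_trans (_ : \sum_(i < n | (i < n./2)%N) `|u i| * V (n - i)%N <= _).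
    apply: ler_sum => i hi; apply: ler_wpM2l => //; apply: V_nd.
    rewrite leq_subRL; last exact: ltnW.
    by rewrite -[leqRHS]odd_double_half -addnn addnA leq_add2r (leq_trans (ltnW hi)) // leq_addl.
  rewrite lerDl; apply: sumr_ge0 => i _; apply: mulr_ge0 => //.
  by rewrite /V /series /=; apply: sumr_ge0.
have half : (fun n : nat => n./2) @ \oo --> \oo.
  apply/cvgnyPge => A; exists A.*2 => //= n /= An.
  by rewrite -[A]doubleK half_leq.
have UV : (U n * V n - U n./2 * V n./2) @[n --> \oo] -->
    limn U * limn V - limn U * limn V.
  apply: cvgB; first exact: cvgM.
  by apply: cvgM; [exact: cvg_comp half cu|exact: cvg_comp half cv].
rewrite subrr in UV.
have D0 : (C n - series u n * series v n) @[n --> \oo] --> (0 : R).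
  apply/norm_cvg0P; apply: squeeze_cvgr (cvg_cst 0) UV.
  by near=> n; rewrite normr_ge0 bound.
have -> : series (fun m => \sum_(i < m.+1) u i * v (m - i)%N) =
    (fun n => (C n - series u n * series v n) + series u n * series v n).
  by apply/funext => n; rewrite subrK.
rewrite -[X in _ --> X]add0r; apply: cvgD => //.
by apply: cvgM; apply: normed_cvg.
Unshelve. all: by end_near. Qed.

Definition entire {R : realType} (f : R -> R) : Prop :=
  exists c : nat -> R, forall x, (pseries c x @ \oo --> f x)%classic.

(** Convergence at the larger point $|x|+1$ forces absolute convergence at $x$. *)
Lemma cvg_pseries_norm {R : realType} (c : nat -> R) (x : R) :
  (forall x, cvgn (pseries c x)) -> cvgn [normed series (fun i => c i * x ^+ i)].
Proof.
move=> h.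
have := @is_cvg_pseries_inside_norm R c (`|x| + 1) `|x| (h _).
rewrite normr_id [`|_ + 1|]ger0_norm ?addr_ge0 // ltrDl ltr01 => /(_ isT).
have -> // : pseries (fun i => `|c i|) `|x| = [normed series (fun i => c i * x ^+ i)].
by apply/funext => n; apply: eq_bigr => i _; rewrite /= normrM normrX.
Qed.

Lemma entire_cst {R : realType} (a : R) : entire (fun=> a).
Proof.
exists (fun n => if n is 0%N then a else 0) => x.
apply: (@cvg_near_cst _ _ a); exists 1%N => //= n /= n0.
rewrite /pseries /series /= -(prednK n0) big_nat_recl //= expr0 mulr1.
by rewrite big1_seq ?addr0 // => i _; rewrite mul0r.
Qed.

Lemma entire_id {R : realType} : entire (fun x : R => x).
Proof.
exists (fun n => (n == 1%N)%:R) => x.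
apply: (@cvg_near_cst _ _ x); exists 2%N => //= n /= n1.
rewrite /pseries /series /= -(prednK (ltnW n1)) big_nat_recl //= mul0r add0r.
rewrite -(prednK (_ : 0 < n.-1)%N); last by rewrite -ltnS prednK // ltnW.
rewrite big_nat_recl //= mul1r expr1 big1_seq ?addr0 // => i _.
by rewrite mul0r.
Qed.

Lemma entireD {R : realType} (f g : R -> R) :
  entire f -> entire g -> entire (fun x => f x + g x).
Proof.
move=> [c hc] [d hd]; exists (fun n => c n + d n) => x.
have -> : pseries (fun n => c n + d n) x =
    (fun n => pseries c x n + pseries d x n).
  apply/funext => n; rewrite /pseries /series /= -big_split /=.
  by apply: eq_bigr => i _; rewrite mulrDl.
exact: cvgD.
Qed.

Lemma entireM {R : realType} (f g : R -> R) :
  entire f -> entire g -> entire (fun x => f x * g x).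
Proof.
move=> [c hc] [d hd]; exists (fun n => \sum_(i < n.+1) c i * d (n - i)%N) => x.
rewrite -(cvg_lim (@Rhausdorff R) (hc x)) -(cvg_lim (@Rhausdorff R) (hd x)).
have cvc y : cvgn (pseries c y) by apply/cvg_ex; exists (f y).
have cvd y : cvgn (pseries d y) by apply/cvg_ex; exists (g y).
have -> : pseries (fun n => \sum_(i < n.+1) c i * d (n - i)%N) x =
    series (fun m => \sum_(i < m.+1) c i * x ^+ i * (d (m - i)%N * x ^+ (m - i))).
  apply/funext => n; rewrite /pseries /series /=.
  apply: eq_bigr => m _; rewrite mulr_suml; apply: eq_bigr => i _.
  by rewrite mulrACA -exprD subnKC // -ltnS.
exact: cvg_cauchy_product (@cvg_pseries_norm R c x cvc) (@cvg_pseries_norm R d x cvd).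
Qed.

Lemma entireZ {R : realType} (a : R) (f : R -> R) :
  entire f -> entire (fun x => a * f x).
Proof. by apply: entireM; exact: entire_cst. Qed.

Lemma entireN {R : realType} (f : R -> R) : entire f -> entire (fun x => - f x).
Proof. by move=> /(entireZ (-1)) h; under eq_fun do rewrite -mulN1r. Qed.

Lemma entireB {R : realType} (f g : R -> R) :
  entire f -> entire g -> entire (fun x => f x - g x).
Proof. by move=> hf hg; apply: entireD => //; apply: entireN. Qed.

Lemma entire_sum {R : realType} (I : Type) (r : seq I) (f : I -> R -> R) :
  (forall i, entire (f i)) -> entire (fun x => \sum_(i <- r) f i x).
Proof.
move=> h; elim: r => [|i r IH].
  by under eq_fun do rewrite big_nil; exact: entire_cst.
by under eq_fun do rewrite big_cons; exact: entireD.
Qed.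

(** Since $n+1\le2^{n+1}$, the term $(n+1)|c_{n+1}||x|^n$ is dominated by $|c_{n+1}|r^{n+1}$ with
    $r=2(|x|+1)$, a term of a series already known to converge absolutely. *)
Lemma cvg_pseries_diffs {R : realType} (c : nat -> R) :
  (forall x, cvgn (pseries c x)) -> forall x, cvgn (pseries (pseries_diffs c) x).
Proof.
move=> h x; apply: normed_cvg; pose r := 2 * (`|x| + 1).
apply: (@series_le_cvg R (fun n => `|pseries_diffs c n * x ^+ n|)
  (fun n => `|c n.+1 * r ^+ n.+1|)) => // [n /=|].
  rewrite !normrM mulrAC mulrC ler_wpM2l // normr_nat /r.
  rewrite [`|_ ^+ n.+1|]ger0_norm ?exprn_ge0 ?mulr_ge0 ?addr_ge0 // exprMn.
  apply: ler_pM => //.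
    by rewrite -natrX ler_nat ltnW // ltn_expl.
  rewrite normrX (le_trans (_ : _ <= (`|x| + 1) ^+ n)) //.
    by rewrite lerXn2r ?qualifE /= ?addr_ge0 // lerDl.
  by rewrite ler_weXn2l // lerDr.
have := @cvg_pseries_norm R c r h.
rewrite -(is_cvg_series_restrict 1) => /cvg_ex[l].
rewrite -cvg_shiftS => hl; apply/cvg_ex; exists l.
have -> : series (fun n => `|c n.+1 * r ^+ n.+1|) =
    (fun n => \sum_(1 <= k < n.+1) `|c k * r ^+ k|).
  by apply/funext => n; rewrite /series /= big_add1.
exact: hl.
Qed.

Lemma is_derive_pseries {R : realType} (c : nat -> R) (f : R -> R) (x d : R) :
  (forall y, pseries c y @ \oo --> f y) -> pseries (pseries_diffs c) x @ \oo --> d ->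
  is_derive x (1 : R) f d.
Proof.
move=> hc hd; rewrite -(cvg_lim (@Rhausdorff R) hd).
have cvc y : cvgn (pseries c y) by apply/cvg_ex; exists (f y).
have -> : f = (fun x => limn (pseries c x)).
  by apply/funext => y; rewrite (cvg_lim (@Rhausdorff R) (hc y)).
apply: (@pseries_snd_diffs R c (`|x| + 1)) => //.
- exact: cvg_pseries_diffs.
- by apply: cvg_pseries_diffs; apply: cvg_pseries_diffs.
- by rewrite [ltRHS]ger0_norm ?addr_ge0 // ltrDl.
Qed.

Lemma entire_derive {R : realType} (f : R -> R) : entire f ->
  exists2 df, entire df & forall x : R, is_derive x (1 : R) f (df x).
Proof.
move=> [c hc].
have cvd y : cvgn (pseries (pseries_diffs c) y).
  by apply: cvg_pseries_diffs => z; apply/cvg_ex; exists (f z).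
exists (fun x => limn (pseries (pseries_diffs c) x)).
  by exists (pseries_diffs c) => x; apply: cvd.
by move=> x; apply: is_derive_pseries (cvd x).
Qed.

Lemma entire_continuous {R : realType} (f : R -> R) : entire f -> continuous f.
Proof.
move=> /entire_derive[df _ h] x.
by apply/differentiable_continuous/derivable1_diffP; case: (h x).
Qed.

(** The zeroth coefficient is $f(0)=0$, so shifting the coefficients divides by $x$. This is how a
    factor $g$ is cancelled. *)
Lemma entire_div {R : realType} (f : R -> R) : entire f -> f 0 = 0 ->
  exists2 h, entire h & forall x, f x = x * h x.
Proof.
move=> [c hc] f0.
have cvc y : cvgn (pseries c y) by apply/cvg_ex; exists (f y).
have c0 : c 0%N = 0.
  rewrite -f0; apply: cvg_unique (hc 0) => //.
  apply: (@cvg_near_cst _ _ (c 0%N)); exists 1%N => //= n /= n0.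
  rewrite /pseries /series /= -(prednK n0) big_nat_recl //= expr0 mulr1.
  by rewrite big1_seq ?addr0 // => i _; rewrite exprS mul0r mulr0.
have sE x n : pseries c x n.+1 = x * pseries (fun k => c k.+1) x n.
  rewrite /pseries /series /= big_nat_recl //= c0 mul0r add0r mulr_sumr.
  by apply: eq_bigr => i _; rewrite exprS mulrCA.
have hcv x : x != 0 -> pseries (fun k => c k.+1) x @ \oo --> f x / x.
  move=> x0; have := hc x; rewrite -cvg_shiftS => h.
  have -> : pseries (fun k => c k.+1) x = (fun n => pseries c x n.+1 / x).
    by apply/funext => n; rewrite sE mulrC mulKf.
  by apply: cvgM => //; exact: cvg_cst.
exists (fun x => limn (pseries (fun k => c k.+1) x)).
  exists (fun k => c k.+1) => x; have [->|/hcv h] := eqVneq x 0.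
    (* At $0$ division says nothing; the shifted series converges there because it converges at
       $1$. *)
    by apply: (@is_cvg_pseries_inside R _ 1); rewrite ?normr0 ?normr1 //;
      apply/cvg_ex; exists (f 1 / 1); apply: hcv; rewrite oner_neq0.
  by apply/cvg_ex; eexists; exact: h.
move=> x; have [->|x0] := eqVneq x 0; first by rewrite mul0r.
by rewrite (cvg_lim (@Rhausdorff R) (hcv _ x0)) mulrCA divff // mulr1.
Qed.

Lemma continuous_le_right {R : realType} (h : R -> R) (B : R) :
  continuous h -> (forall x, 0 < x -> h x <= B) -> h 0 <= B.
Proof.
move=> ch hB; have hr : h x @[x --> 0^'+] --> h 0.
  by apply: cvg_at_right_filter; exact: ch.
apply: (cvgr_to_le hr) => //.
by near=> x; apply: hB.
Unshelve. all: by end_near. Qed.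

(** * Complex matrices and their exponentials *)

Section ComplexParts.
Variable R : realType.
Implicit Types x y : R[i].

Lemma ReD x y : complex.Re (x + y) = complex.Re x + complex.Re y.
Proof. by case: x; case: y. Qed.

Lemma ImD x y : complex.Im (x + y) = complex.Im x + complex.Im y.
Proof. by case: x; case: y. Qed.

Lemma ReN x : complex.Re (- x) = - complex.Re x.
Proof. by case: x. Qed.

Lemma ImN x : complex.Im (- x) = - complex.Im x.
Proof. by case: x. Qed.

Lemma ReM x y :
  complex.Re (x * y) = complex.Re x * complex.Re y - complex.Im x * complex.Im y.
Proof. by case: x; case: y. Qed.

Lemma ImM x y :
  complex.Im (x * y) = complex.Re x * complex.Im y + complex.Im x * complex.Re y.
Proof. by case: x; case: y. Qed.

Lemma ReJ x : complex.Re (x^*)%C = complex.Re x.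
Proof. by case: x. Qed.

Lemma ImJ x : complex.Im (x^*)%C = - complex.Im x.
Proof. by case: x. Qed.

Lemma ReZ (a : R) x : complex.Re (a%:C * x) = a * complex.Re x.
Proof. by rewrite ReM /= mul0r subr0. Qed.

Lemma ImZ (a : R) x : complex.Im (a%:C * x) = a * complex.Im x.
Proof. by rewrite ImM /= mul0r addr0. Qed.

Lemma Re_sum (I : Type) (r : seq I) (P : pred I) (F : I -> R[i]) :
  complex.Re (\sum_(i <- r | P i) F i) = \sum_(i <- r | P i) complex.Re (F i).
Proof. exact: (big_morph _ ReD). Qed.

Lemma Im_sum (I : Type) (r : seq I) (P : pred I) (F : I -> R[i]) :
  complex.Im (\sum_(i <- r | P i) F i) = \sum_(i <- r | P i) complex.Im (F i).
Proof. exact: (big_morph _ ImD). Qed.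

Lemma complex_eqP x y :
  complex.Re x = complex.Re y -> complex.Im x = complex.Im y -> x = y.
Proof. by case: x; case: y => ? ? ? ? /= -> ->. Qed.

End ComplexParts.

Section Adjoint.
Variable R : realType.

Lemma adjmxD (m n : nat) (A B : 'M[R[i]]_(m, n)) : (A + B)^t* = A^t* + B^t*.
Proof. by rewrite linearD /= map_mxD. Qed.

Lemma adjmxN (m n : nat) (A : 'M[R[i]]_(m, n)) : (- A)^t* = - A^t*.
Proof. by rewrite linearN /= map_mxN. Qed.

Lemma adjmxZ (m n : nat) (c : R[i]) (A : 'M[R[i]]_(m, n)) :
  (c *: A)^t* = (c^*)%C *: A^t*.
Proof. by rewrite linearZ /= map_mxZ. Qed.

Lemma adjmxM (m n p : nat) (A : 'M[R[i]]_(m, n)) (B : 'M[R[i]]_(n, p)) :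
  (A *m B)^t* = B^t* *m A^t*.
Proof. by rewrite trmx_mul map_mxM. Qed.

Lemma adjmx1 (n : nat) : (1%:M : 'M[R[i]]_n)^t* = 1%:M.
Proof. by rewrite trmx1 map_mx1. Qed.

Lemma adjmxX (n : nat) (A : 'M[R[i]]_n) (k : nat) : (A ^+ k)^t* = (A^t*) ^+ k.
Proof.
elim: k => [|k IH]; first by rewrite !expr0 adjmx1.
by rewrite exprS exprSr -mulmxE adjmxM IH.
Qed.

Lemma adjmxE (m n : nat) (A : 'M[R[i]]_(m, n)) i j : (A^t*) i j = ((A j i)^*)%C.
Proof. by rewrite !mxE. Qed.

End Adjoint.

(** * Entrywise calculus of matrix-valued functions *)

Section MatrixCalculus.
Variable R : realType.

Definition entire_mx (m n : nat) (F : R -> 'M[R[i]]_(m, n)) : Prop :=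
  forall i j, entire (fun t => complex.Re (F t i j)) /\
              entire (fun t => complex.Im (F t i j)).

Lemma entire_mx_cst (m n : nat) (A : 'M[R[i]]_(m, n)) : entire_mx (fun=> A).
Proof. by move=> i j; split; apply: entire_cst. Qed.

Lemma entire_mxD (m n : nat) (F G : R -> 'M[R[i]]_(m, n)) :
  entire_mx F -> entire_mx G -> entire_mx (fun t => F t + G t).
Proof.
move=> hF hG i j; have [Fr Fi] := hF i j; have [Gr Gi] := hG i j.
by split; under eq_fun do rewrite mxE ?ReD ?ImD; apply: entireD.
Qed.

Lemma entire_mxN (m n : nat) (F : R -> 'M[R[i]]_(m, n)) :
  entire_mx F -> entire_mx (fun t => - F t).
Proof.
move=> hF i j; have [Fr Fi] := hF i j.
by split; under eq_fun do rewrite mxE ?ReN ?ImN; apply: entireN.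
Qed.

Lemma entire_mxB (m n : nat) (F G : R -> 'M[R[i]]_(m, n)) :
  entire_mx F -> entire_mx G -> entire_mx (fun t => F t - G t).
Proof. by move=> hF hG; apply: entire_mxD => //; apply: entire_mxN. Qed.

Lemma entire_mxM (m n p : nat) (F : R -> 'M[R[i]]_(m, n))
    (G : R -> 'M[R[i]]_(n, p)) :
  entire_mx F -> entire_mx G -> entire_mx (fun t => F t *m G t).
Proof.
move=> hF hG i j; split; under eq_fun do rewrite mxE ?Re_sum ?Im_sum.
  apply: entire_sum => k; have [Fr Fi] := hF i k; have [Gr Gi] := hG k j.
  by under eq_fun do rewrite ReM; apply: entireB; apply: entireM.
apply: entire_sum => k; have [Fr Fi] := hF i k; have [Gr Gi] := hG k j.
by under eq_fun do rewrite ImM; apply: entireD; apply: entireM.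
Qed.

Lemma entire_mx_adj (m n : nat) (F : R -> 'M[R[i]]_(m, n)) :
  entire_mx F -> entire_mx (fun t => (F t)^t*).
Proof.
move=> hF i j; have [Fr Fi] := hF j i.
split; first by under eq_fun do rewrite adjmxE ReJ.
by under eq_fun do rewrite adjmxE ImJ; apply: entireN.
Qed.

Lemma entire_mx_tr (n : nat) (F : R -> 'M[R[i]]_n) : entire_mx F ->
  entire (fun t => complex.Re (\tr (F t))) /\ entire (fun t => complex.Im (\tr (F t))).
Proof.
move=> hF; split; under eq_fun do rewrite /mxtrace ?Re_sum ?Im_sum;
  by apply: entire_sum => i; case: (hF i i).
Qed.

Lemma is_derive_mx_cst (m n : nat) (A : 'M[R[i]]_(m, n)) (t : R) :
  is_derive_mx (fun=> A) t 0.
Proof. by move=> i j; rewrite mxE; split; apply: is_derive_cst. Qed.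

Lemma is_derive_mx_adj (m n : nat) (F : R -> 'M[R[i]]_(m, n)) (t : R) dF :
  is_derive_mx F t dF -> is_derive_mx (fun s => (F s)^t*) t (dF^t*).
Proof.
move=> hF i j; have [Fr Fi] := hF j i.
split; first by under eq_fun do rewrite adjmxE ReJ; rewrite adjmxE ReJ.
by under eq_fun do rewrite adjmxE ImJ; rewrite adjmxE ImJ; apply: is_deriveN.
Qed.

Lemma is_derive_bigsum (n : nat) (h : 'I_n -> R -> R) (dh : 'I_n -> R) (t : R) :
  (forall i, is_derive t (1 : R) (h i) (dh i)) ->
  is_derive t (1 : R) (fun s => \sum_(i < n) h i s) (\sum_(i < n) dh i).
Proof.
move=> H; have := is_derive_sum H; congr (is_derive _ _ _ _).
by apply/funext => s; rewrite fct_sumE.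
Qed.

Lemma is_derive_mul (f g : R -> R) (t df dg : R) :
  is_derive t (1 : R) f df -> is_derive t (1 : R) g dg ->
  is_derive t (1 : R) (fun s => f s * g s) (df * g t + f t * dg).
Proof.
move=> hf hg; have := is_deriveM hf hg.
by rewrite addrC /GRing.scale /= [g t * df]mulrC.
Qed.

Lemma is_derive_mxM (m n p : nat) (F : R -> 'M[R[i]]_(m, n))
    (G : R -> 'M[R[i]]_(n, p)) (t : R) dF dG :
  is_derive_mx F t dF -> is_derive_mx G t dG ->
  is_derive_mx (fun s => F s *m G s) t (dF *m G t + F t *m dG).
Proof.
move=> hF hG i j; split.
  under eq_fun do rewrite mxE Re_sum; rewrite !mxE ReD !Re_sum -big_split /=.
  apply: is_derive_bigsum => k; have [Fr Fi] := hF i k; have [Gr Gi] := hG k j.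
  under eq_fun do rewrite ReM; rewrite !ReM.
  have := is_deriveB (is_derive_mul Fr Gr) (is_derive_mul Fi Gi).
  by congr (is_derive _ _ _ _); ring.
under eq_fun do rewrite mxE Im_sum; rewrite !mxE ImD !Im_sum -big_split /=.
apply: is_derive_bigsum => k; have [Fr Fi] := hF i k; have [Gr Gi] := hG k j.
under eq_fun do rewrite ImM; rewrite !ImM.
have := is_deriveD (is_derive_mul Fr Gi) (is_derive_mul Fi Gr).
by congr (is_derive _ _ _ _); ring.
Qed.

Lemma is_derive_mx_0_is_cst (m n : nat) (F : R -> 'M[R[i]]_(m, n)) (s t : R) :
  (forall u, is_derive_mx F u 0) -> F s = F t.
Proof.
move=> h; apply/matrixP => i j; apply: complex_eqP.
  apply: (@is_derive_0_is_cst R (fun u => complex.Re (F u i j))) => u.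
  by have [] := h u i j; rewrite mxE.
apply: (@is_derive_0_is_cst R (fun u => complex.Im (F u i j))) => u.
by have [] := h u i j; rewrite mxE.
Qed.

End MatrixCalculus.

Section Exponential.
Variables (R : realType) (N : nat).
Implicit Types L : 'M[R[i]]_N.

Lemma mx_entry_bound L : exists2 M : R, 0 <= M & forall i j,
  `|complex.Re (L i j)| <= M /\ `|complex.Im (L i j)| <= M.
Proof.
exists (\sum_i \sum_j (`|complex.Re (L i j)| + `|complex.Im (L i j)|)).
  by apply: sumr_ge0 => i _; apply: sumr_ge0 => j _; rewrite addr_ge0.
move=> i j; have le : `|complex.Re (L i j)| + `|complex.Im (L i j)| <=
    \sum_i \sum_j (`|complex.Re (L i j)| + `|complex.Im (L i j)|).
  rewrite (bigD1 i) //= (bigD1 j) //= -addrA lerDl addr_ge0 //.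
    by apply: sumr_ge0 => k _; rewrite addr_ge0.
  by apply: sumr_ge0 => k _; apply: sumr_ge0 => l _; rewrite addr_ge0.
by split; apply: le_trans le; rewrite ?lerDl ?lerDr.
Qed.

(** An entry of $L\,L^k$ is a sum of $N$ complex products, and the real or imaginary part of each
    consists of two real products; one more power thus costs a factor $2Nm$, with $m$ a bound on the
    entries of $L$. *)
Lemma mx_power_bound L : exists2 M : R, 0 <= M & forall k i j,
  `|complex.Re ((L ^+ k) i j)| <= M ^+ k /\ `|complex.Im ((L ^+ k) i j)| <= M ^+ k.
Proof.
have [m m0 hm] := mx_entry_bound L; exists (N%:R * (2 * m)).
  by rewrite !mulr_ge0.
elim=> [|k IH] i j.
  rewrite !expr0 mxE; case: (i == j) => /=; rewrite ?normr1 ?normr0 ?ler01 //.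
set M := N%:R * (2 * m) in IH *.
have M0 : 0 <= M by rewrite !mulr_ge0.
have key (f : 'I_N -> R) : (forall l, `|f l| <= 2 * m * M ^+ k) ->
    `|\sum_l f l| <= M ^+ k.+1.
  move=> hf; apply: le_trans (ler_norm_sum _ _ _) _.
  apply: le_trans (ler_sum _ (fun l _ => hf l)) _.
  by rewrite sumr_const card_ord exprS -[_ *+ N]mulr_natl {2}/M !mulrA.
rewrite exprS -mulmxE mxE Re_sum Im_sum; split; apply: key => l;
  have [a b] := hm i l; have [c d] := IH l j; rewrite ?ReM ?ImM.
  rewrite (le_trans (ler_normB _ _)) // !normrM.
  by rewrite -mulrA mulr_natl mulr2n; apply: lerD; apply: ler_pM.
rewrite (le_trans (ler_normD _ _)) // !normrM.
by rewrite -mulrA mulr_natl mulr2n; apply: lerD; apply: ler_pM.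
Qed.

Lemma cvg_pseries_fact (c : nat -> R) (M : R) : 0 <= M ->
  (forall k, `|c k| <= M ^+ k) ->
  forall t, cvgn (pseries (fun k => c k / k`!%:R) t).
Proof.
move=> M0 hc t; apply: normed_cvg.
apply: (@series_le_cvg R (fun k => `|c k / k`!%:R * t ^+ k|) (exp_coeff (M * `|t|))) => //.
- by move=> k; rewrite exp_coeff_ge0 ?mulr_ge0.
- move=> k /=; rewrite /exp_coeff /= !normrM normfV normr_nat exprMn normrX mulrAC.
  by rewrite ler_wpM2r ?invr_ge0 // ler_wpM2r.
- exact: is_cvg_series_exp_coeff.
Qed.

Lemma scalemx_exp (a : R[i]) L (k : nat) : (a *: L) ^+ k = a ^+ k *: L ^+ k.
Proof.
elim: k => [|k IH]; first by rewrite !expr0 scale1r.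
by rewrite !exprS IH -!mulmxE -scalemxAl -scalemxAr scalerA.
Qed.

Lemma expmx_partialE L (t : R) (m : nat) i j :
  (\sum_(k < m) (k`!%:R)^-1 *: (t%:C *: L) ^+ k) i j =
  \sum_(k < m) (t ^+ k / k`!%:R)%:C * (L ^+ k) i j.
Proof.
rewrite summxE; apply: eq_bigr => k _.
rewrite scalemx_exp scalerA mxE; congr (_ * _).
by rewrite rmorphM /= rmorphXn /= fmorphV /= rmorph_nat mulrC.
Qed.

(** [expmx] is defined through [lim], which is meaningful only once the partial sums converge; this
    is where that is established, by domination with a real exponential series. *)
Lemma expmx_pseries L (t : R) i j :
  (pseries (fun k => complex.Re ((L ^+ k) i j) / k`!%:R) t @ \oo -->
    complex.Re (expmx (t%:C *: L) i j)) /\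
  (pseries (fun k => complex.Im ((L ^+ k) i j) / k`!%:R) t @ \oo -->
    complex.Im (expmx (t%:C *: L) i j)).
Proof.
have [M M0 hM] := mx_power_bound L.
(* [f] stands for the real or the imaginary part; only linearity over [R] matters, the coefficients
   $t^k/k!$ being real. *)
have partialE (f : R[i] -> R) (fD : {morph f : x y / x + y >-> x + y})
    (f0 : f 0 = 0) (fZ : forall a x, f (a%:C * x) = a * f x) :
    (fun m => f ((\sum_(k < m) (k`!%:R)^-1 *: (t%:C *: L) ^+ k) i j)) =
    pseries (fun k => f ((L ^+ k) i j) / k`!%:R) t.
  apply/funext => m; rewrite expmx_partialE (big_morph f fD f0).
  rewrite /pseries /series /= big_mkord; apply: eq_bigr => k _.
  by rewrite fZ; ring.
split; rewrite mxE /clim /=.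
- rewrite (partialE _ (@ReD R) erefl (@ReZ R)).
  by apply: (cvg_pseries_fact M0) => k; case: (hM k i j).
- rewrite (partialE _ (@ImD R) erefl (@ImZ R)).
  by apply: (cvg_pseries_fact M0) => k; case: (hM k i j).
Qed.

Lemma entire_mx_expmx L : entire_mx (fun t : R => expmx (t%:C *: L)).
Proof.
move=> i j; split.
  by exists (fun k => complex.Re ((L ^+ k) i j) / k`!%:R) => t; case: (expmx_pseries L t i j).
by exists (fun k => complex.Im ((L ^+ k) i j) / k`!%:R) => t; case: (expmx_pseries L t i j).
Qed.

Lemma expmx0 : expmx (0 : 'M[R[i]]_N) = 1%:M.
Proof.
apply/matrixP => i j; have [] := expmx_pseries 0 0 i j; rewrite scaler0.
have z (c : nat -> R) : pseries c 0 @ \oo --> c 0%N.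
  apply: (@cvg_near_cst _ _ (c 0%N)); exists 1%N => //= n /= n0.
  rewrite /pseries /series /= -(prednK n0) big_nat_recl //= expr0 mulr1.
  by rewrite big1_seq ?addr0 // => l _; rewrite exprS mul0r mulr0.
move=> hr hi; apply: complex_eqP.
  by rewrite -(cvg_unique _ (z _) hr) // expr0 divr1.
by rewrite -(cvg_unique _ (z _) hi) // expr0 divr1.
Qed.

Lemma expmx_adj L : (expmx L)^t* = expmx (L^t*).
Proof.
apply/matrixP => i j; rewrite adjmxE.
have [] := expmx_pseries L 1 j i; have [] := expmx_pseries (L^t*) 1 i j.
rewrite !scale1r => rA iA rL iL; apply: complex_eqP.
  rewrite ReJ; apply: cvg_unique rL _ => //.
  have -> // : (fun k => complex.Re ((L ^+ k) j i) / k`!%:R) =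
      (fun k => complex.Re (((L^t*) ^+ k) i j) / k`!%:R).
  by apply/funext => k; rewrite -adjmxX adjmxE ReJ.
rewrite ImJ; apply: cvg_unique (cvgN iL) _ => //.
have -> // : - pseries (fun k => complex.Im ((L ^+ k) j i) / k`!%:R) 1 =
    pseries (fun k => complex.Im (((L^t*) ^+ k) i j) / k`!%:R) 1.
apply/funext => m.
rewrite [LHS](_ : _ = - \sum_(0 <= k < m) (complex.Im ((L ^+ k) j i) / k`!%:R * 1 ^+ k)) //.
rewrite -sumrN; apply: eq_bigr => k _.
by rewrite /= -adjmxX adjmxE ImJ !mulNr.
Qed.

Lemma cvg_bigsum (I : Type) (r : seq I) (f : I -> nat -> R) (l : I -> R) :
  (forall i, f i @ \oo --> l i) ->
  (fun n => \sum_(i <- r) f i n) @ \oo --> \sum_(i <- r) l i.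
Proof.
move=> h; elim: r => [|i r IH].
  by rewrite big_nil; under eq_fun do rewrite big_nil; exact: cvg_cst.
by rewrite big_cons; under eq_fun do rewrite big_cons; exact: cvgD.
Qed.

(** Formal differentiation turns the coefficient $L^k/k!$ into $L^{k+1}/k!=L\cdot L^k/k!$, and the
    constant matrix $L$ comes out on the left. *)
Lemma is_derive_expmx L (t : R) :
  is_derive_mx (fun s : R => expmx (s%:C *: L)) t (L *m expmx (t%:C *: L)).
Proof.
have diffE (f : R[i] -> R) i j :
    pseries_diffs (fun k => f ((L ^+ k) i j) / k`!%:R) =
    (fun k => f (\sum_l L i l * (L ^+ k) l j) / k`!%:R).
  apply/funext => k; rewrite /pseries_diffs factS natrM invfM.
  rewrite mulrCA mulVKf ?pnatr_eq0 //.
  by rewrite exprS -mulmxE mxE.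
move=> i j; split.
  apply: (@is_derive_pseries R (fun k => complex.Re ((L ^+ k) i j) / k`!%:R)).
    by move=> s; case: (expmx_pseries L s i j).
  rewrite diffE mxE Re_sum.
  have -> : pseries (fun k => complex.Re (\sum_l L i l * (L ^+ k) l j) / k`!%:R) t =
    (fun m => \sum_l (complex.Re (L i l) * pseries (fun k => complex.Re ((L ^+ k) l j) / k`!%:R) t m
      - complex.Im (L i l) * pseries (fun k => complex.Im ((L ^+ k) l j) / k`!%:R) t m)).
    apply/funext => m; rewrite /pseries /series /=.
    under [RHS]eq_bigr do rewrite !mulr_sumr -sumrB.
    rewrite exchange_big /=; apply: eq_bigr => k _.
    rewrite Re_sum mulr_suml mulr_suml; apply: eq_bigr => l _.
    by rewrite ReM; ring.
  apply: cvg_bigsum => l; have [hr hi] := expmx_pseries L t l j.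
  rewrite ReM; apply: cvgB; (apply: cvgM; [exact: cvg_cst|by []]).
apply: (@is_derive_pseries R (fun k => complex.Im ((L ^+ k) i j) / k`!%:R)).
  by move=> s; case: (expmx_pseries L s i j).
rewrite diffE mxE Im_sum.
have -> : pseries (fun k => complex.Im (\sum_l L i l * (L ^+ k) l j) / k`!%:R) t =
  (fun m => \sum_l (complex.Re (L i l) * pseries (fun k => complex.Im ((L ^+ k) l j) / k`!%:R) t m
    + complex.Im (L i l) * pseries (fun k => complex.Re ((L ^+ k) l j) / k`!%:R) t m)).
  apply/funext => m; rewrite /pseries /series /=.
  under [RHS]eq_bigr do rewrite !mulr_sumr -big_split.
  rewrite exchange_big /=; apply: eq_bigr => k _.
  rewrite Im_sum mulr_suml mulr_suml; apply: eq_bigr => l _.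
  by rewrite ImM; ring.
apply: cvg_bigsum => l; have [hr hi] := expmx_pseries L t l j.
rewrite ImM; apply: cvgD; (apply: cvgM; [exact: cvg_cst|by []]).
Qed.

End Exponential.

(** * The flow of a plaquette *)

Lemma eq_is_derive_mx {R : realType} (m n : nat) (F G : R -> 'M[R[i]]_(m, n)) (t : R) dF dG :
  F =1 G -> dF = dG -> is_derive_mx F t dF -> is_derive_mx G t dG.
Proof. by move=> /funext <- <-. Qed.

Ltac prove_entire_mx := lazymatch goal with
  | |- entire_mx (fun t => @?F t + @?G t) => refine (@entire_mxD _ _ _ F G _ _); prove_entire_mx
  | |- entire_mx (fun t => - @?F t) => refine (@entire_mxN _ _ _ F _); prove_entire_mx
  | |- entire_mx (fun t => @?F t *m @?G t) => refine (@entire_mxM _ _ _ _ F G _ _); prove_entire_mx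
  | |- entire_mx (fun t => (@?F t)^t*) => refine (@entire_mx_adj _ _ _ F _); prove_entire_mx
  | |- entire_mx (fun t => expmx (t%:C *: ?L)) => exact (@entire_mx_expmx _ _ L)
  | |- entire_mx (fun t => flow ?L t ?j) => exact (@entire_mx_expmx _ _ (L j))
  | |- entire_mx (fun t => ?A) => exact (@entire_mx_cst _ _ _ A)
  end.

Lemma is_derive_mxM5 {R : realType} (n : nat) (F G H K M : R -> 'M[R[i]]_n) (t : R)
    dF dG dH dK dM :
  is_derive_mx F t dF -> is_derive_mx G t dG -> is_derive_mx H t dH ->
  is_derive_mx K t dK -> is_derive_mx M t dM ->
  is_derive_mx (fun s => F s *m G s *m H s *m K s *m M s) t
    (dF *m G t *m H t *m K t *m M t + F t *m dG *m H t *m K t *m M t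
     + F t *m G t *m dH *m K t *m M t + F t *m G t *m H t *m dK *m M t
     + F t *m G t *m H t *m K t *m dM).
Proof.
move=> hF hG hH hK hM.
have h := is_derive_mxM (is_derive_mxM (is_derive_mxM (is_derive_mxM hF hG) hH) hK) hM.
by apply: eq_is_derive_mx h => //; rewrite !mulmxDl.
Qed.

(* The expansion [plaqdM] over any ring, with [U_3^t*] and [U_4^t*] replaced by
   independent matrices [V3] and [V4]. *)
Definition plaqdM_of {K : pzRingType} (n : nat) (j : 'I_4)
    (L1 L2 L3 L4 U1 U2 V3 V4 : 'M[K]_n) : 'M[K]_n :=
  nth 0
    [:: L1 *m L1 *m U1 *m U2 *m V3 *m V4 + L1 *m U1 *m L2 *m U2 *m V3 *m V4
        - L1 *m U1 *m U2 *m L3 *m V3 *m V4 - L1 *m U1 *m U2 *m V3 *m L4 *m V4;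
        L1 *m U1 *m L2 *m U2 *m V3 *m V4 + U1 *m L2 *m L2 *m U2 *m V3 *m V4
        - U1 *m L2 *m U2 *m L3 *m V3 *m V4 - U1 *m L2 *m U2 *m V3 *m L4 *m V4;
        L1 *m U1 *m U2 *m L3 *m V3 *m V4 + U1 *m L2 *m U2 *m L3 *m V3 *m V4
        - U1 *m U2 *m L3 *m L3 *m V3 *m V4 - U1 *m U2 *m L3 *m V3 *m L4 *m V4;
        L1 *m U1 *m U2 *m V3 *m L4 *m V4 + U1 *m L2 *m U2 *m V3 *m L4 *m V4
        - U1 *m U2 *m L3 *m V3 *m L4 *m V4 - U1 *m U2 *m V3 *m L4 *m L4 *m V4] j.

(** The left sides have the shape delivered by [is_derive_mxM5]: the inserted generator is a
    constant factor of derivative [0], each $U_k$ has derivative $L_kU_k$, and each $V_k$ has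
    $-L_kV_k$. *)
Lemma product_rule_plaqM {K : pzRingType} (n : nat) (L1 L2 L3 L4 U1 U2 V3 V4 : 'M[K]_n) :
  [/\ 0 *m U1 *m U2 *m V3 *m V4 + L1 *m (L1 *m U1) *m U2 *m V3 *m V4
     + L1 *m U1 *m (L2 *m U2) *m V3 *m V4 + L1 *m U1 *m U2 *m - (L3 *m V3) *m V4
     + L1 *m U1 *m U2 *m V3 *m - (L4 *m V4) =
   plaqdM_of b1 L1 L2 L3 L4 U1 U2 V3 V4,
  L1 *m U1 *m L2 *m U2 *m V3 *m V4 + U1 *m 0 *m U2 *m V3 *m V4
     + U1 *m L2 *m (L2 *m U2) *m V3 *m V4 + U1 *m L2 *m U2 *m - (L3 *m V3) *m V4
     + U1 *m L2 *m U2 *m V3 *m - (L4 *m V4) =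
   plaqdM_of b2 L1 L2 L3 L4 U1 U2 V3 V4,
  L1 *m U1 *m U2 *m L3 *m V3 *m V4 + U1 *m (L2 *m U2) *m L3 *m V3 *m V4
     + U1 *m U2 *m 0 *m V3 *m V4 + U1 *m U2 *m L3 *m - (L3 *m V3) *m V4
     + U1 *m U2 *m L3 *m V3 *m - (L4 *m V4) =
   plaqdM_of b3 L1 L2 L3 L4 U1 U2 V3 V4 &
  L1 *m U1 *m U2 *m V3 *m L4 *m V4 + U1 *m (L2 *m U2) *m V3 *m L4 *m V4
     + U1 *m U2 *m - (L3 *m V3) *m L4 *m V4 + U1 *m U2 *m V3 *m 0 *m V4
     + U1 *m U2 *m V3 *m L4 *m - (L4 *m V4) =
   plaqdM_of b4 L1 L2 L3 L4 U1 U2 V3 V4].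
Proof.
by split; rewrite /plaqdM_of /= !(mulmx0, mul0mx) ?addr0 ?add0r !(mulmxN, mulNmx) !mulmxA.
Qed.

Lemma product_rule_plaq {K : pzRingType} (n : nat) (L1 L2 L3 L4 U1 U2 V3 V4 : 'M[K]_n) :
  ((L1 *m U1 *m U2 + U1 *m (L2 *m U2)) *m V3 + U1 *m U2 *m - (L3 *m V3)) *m V4
    + U1 *m U2 *m V3 *m - (L4 *m V4) =
  L1 *m U1 *m U2 *m V3 *m V4 + U1 *m L2 *m U2 *m V3 *m V4
    - U1 *m U2 *m L3 *m V3 *m V4 - U1 *m U2 *m V3 *m L4 *m V4.
Proof. by rewrite !mulmxDl !(mulmxN, mulNmx) !mulmxA. Qed.

Section Flow.
Variables (R : realType) (N : nat).
Implicit Types L : 'M[R[i]]_N.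

(** Taking adjoints in the left-handed formula for $L^\dagger$ moves the generator to the right,
    without a separate proof that $L$ commutes with its exponential. *)
Lemma is_derive_expmx_r L (t : R) :
  is_derive_mx (fun s : R => expmx (s%:C *: L)) t (expmx (t%:C *: L) *m L).
Proof.
have adjE s : (expmx (s%:C *: L^t*))^t* = expmx (s%:C *: L).
  by rewrite expmx_adj adjmxZ conjc_real trmxCK.
apply: eq_is_derive_mx (is_derive_mx_adj (is_derive_expmx (L^t*) t)) => [s|].
  exact: adjE.
by rewrite adjmxM adjE trmxCK.
Qed.

(** In the derivative of $e^{sL}e^{-sL}$ the right-handed formula for the first factor and the
    left-handed one for the second place both generators in the middle, where they cancel. *)
Lemma expmx_mulN L : expmx L *m expmx (- L) = 1%:M.
Proof.
have h t : is_derive_mx (fun s : R => expmx (s%:C *: L) *m expmx (s%:C *: - L)) t 0.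
  apply: eq_is_derive_mx (is_derive_mxM (is_derive_expmx_r L t) (is_derive_expmx (- L) t)) => //.
  by rewrite mulNmx mulmxN mulmxA subrr.
have := is_derive_mx_0_is_cst 1 0 h.
by rewrite !scale1r !scale0r expmx0 mulmx1.
Qed.

Lemma antiadj_scale L (t : R) : L^t* = - L -> (t%:C *: L)^t* = - (t%:C *: L).
Proof. by move=> hL; rewrite adjmxZ conjc_real hL scalerN. Qed.

Lemma expmx_unitary L : L^t* = - L -> expmx L \is unitarymx.
Proof. by move=> hL; apply/unitarymxP; rewrite expmx_adj hL expmx_mulN. Qed.

Variable LL : 'I_4 -> 'M[R[i]]_N.
Hypothesis LL_anti : forall j, (LL j)^t* = - LL j.

Lemma is_derive_flow j (t : R) :
  is_derive_mx (fun s => flow LL s j) t (LL j *m flow LL t j).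
Proof. exact: is_derive_expmx. Qed.

(** The adjoint of the right-handed derivative has its generator in front of $U_j^\dagger$, the
    position it occupies in [plaqM]. *)
Lemma is_derive_flow_adj j (t : R) :
  is_derive_mx (fun s => (flow LL s j)^t*) t (- (LL j *m (flow LL t j)^t*)).
Proof.
apply: eq_is_derive_mx (is_derive_mx_adj (is_derive_expmx_r (LL j) t)) => //.
by rewrite adjmxM LL_anti mulNmx.
Qed.

Lemma is_derive_plaqM j (t : R) :
  is_derive_mx (fun s => plaqM j LL (flow LL s)) t (plaqdM j LL (flow LL t)).
Proof.
have cst A : is_derive_mx (fun=> A : 'M[R[i]]_N) t 0 := is_derive_mx_cst A t.
have u := is_derive_flow ^~ t; have v := is_derive_flow_adj ^~ t.
case: j => [[|[|[|[|//]]]] hj]; rewrite /plaqM /plaqdM /=.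
- apply: eq_is_derive_mx (is_derive_mxM5 (cst (LL b1)) (u b1) (u b2) (v b3) (v b4)) => [s //|].
  by have [E _ _ _] := @product_rule_plaqM R[i] N (LL b1) (LL b2) (LL b3) (LL b4)
    (flow LL t b1) (flow LL t b2) ((flow LL t b3)^t*) ((flow LL t b4)^t*); exact: E.
- apply: eq_is_derive_mx (is_derive_mxM5 (u b1) (cst (LL b2)) (u b2) (v b3) (v b4)) => [s //|].
  by have [_ E _ _] := @product_rule_plaqM R[i] N (LL b1) (LL b2) (LL b3) (LL b4)
    (flow LL t b1) (flow LL t b2) ((flow LL t b3)^t*) ((flow LL t b4)^t*); exact: E.
- apply: eq_is_derive_mx (is_derive_mxM5 (u b1) (u b2) (cst (LL b3)) (v b3) (v b4)) => [s //|].
  by have [_ _ E _] := @product_rule_plaqM R[i] N (LL b1) (LL b2) (LL b3) (LL b4)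
    (flow LL t b1) (flow LL t b2) ((flow LL t b3)^t*) ((flow LL t b4)^t*); exact: E.
- apply: eq_is_derive_mx (is_derive_mxM5 (u b1) (u b2) (v b3) (cst (LL b4)) (v b4)) => [s //|].
  by have [_ _ _ E] := @product_rule_plaqM R[i] N (LL b1) (LL b2) (LL b3) (LL b4)
    (flow LL t b1) (flow LL t b2) ((flow LL t b3)^t*) ((flow LL t b4)^t*); exact: E.
Qed.

Lemma is_derive_plaq (t : R) :
  let M j := plaqM j LL (flow LL t) in
  is_derive_mx (fun s => plaq (flow LL s)) t (M b1 + M b2 - M b3 - M b4).
Proof.
have u := is_derive_flow ^~ t; have v := is_derive_flow_adj ^~ t.
apply: eq_is_derive_mx
  (is_derive_mxM (is_derive_mxM (is_derive_mxM (u b1) (u b2)) (v b3)) (v b4)) => [s //|].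
exact: (@product_rule_plaq R[i] N (LL b1) (LL b2) (LL b3) (LL b4)
  (flow LL t b1) (flow LL t b2) ((flow LL t b3)^t*) ((flow LL t b4)^t*)).
Qed.

Lemma entire_plaq : entire_mx (fun t => plaq (flow LL t)).
Proof.
by rewrite /plaq; prove_entire_mx.
Qed.

Lemma entire_plaqM j (B : 'I_4 -> 'M[R[i]]_N) : entire_mx (fun t => plaqM j B (flow LL t)).
Proof. by case: j => [[|[|[|[|//]]]] hj]; rewrite /plaqM /plaqdM /=; prove_entire_mx. Qed.

Lemma entire_plaqdM j (B : 'I_4 -> 'M[R[i]]_N) : entire_mx (fun t => plaqdM j B (flow LL t)).
Proof. by case: j => [[|[|[|[|//]]]] hj]; rewrite /plaqM /plaqdM /=; prove_entire_mx. Qed.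

Lemma flow0 j : flow LL 0 j = 1%:M.
Proof. by rewrite /flow scale0r expmx0. Qed.

Lemma plaqM0 j : plaqM j LL (flow LL 0) = LL j.
Proof.
case: j => [[|[|[|[|//]]]] hj]; rewrite /plaqM /= !flow0 adjmx1 !(mulmx1, mul1mx);
  by congr (LL _); apply: val_inj.
Qed.

Lemma plaq0 : plaq (flow LL 0) = 1%:M.
Proof. by rewrite /plaq !flow0 adjmx1 !mulmx1. Qed.

End Flow.

(** * Integrals of matrix-valued functions *)

Section Integration.
Variable R : realType.

Lemma continuous_integrable (f : R -> R) (a b : R) : continuous f ->
  lebesgue_measure.-integrable `[a, b] (EFin \o f).
Proof.
move=> cf; apply: continuous_compact_integrable; first exact: segment_compact.
exact: continuous_subspaceT.
Qed.

Lemma Rintegral_derive (F f : R -> R) (b : R) :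
  (forall x, is_derive x (1 : R) F (f x)) -> continuous f -> 0 <= b ->
  \int[lebesgue_measure]_(x in `[0, b]) f x = F b - F 0.
Proof.
(* The inner integral over $[0,\delta]$ includes $\delta=0$, while the fundamental theorem is
   applied on a nondegenerate interval. *)
move=> dF cf; rewrite le_eqVlt => /predU1P[<-|b0].
  by rewrite set_itv1 Rintegral_set1 subrr.
have cF : continuous F.
  by move=> x; apply/differentiable_continuous/derivable1_diffP; case: (dF x).
rewrite /Rintegral (@continuous_FTC2 R f F 0 b b0) //.
- exact: continuous_subspaceT.
- split; first by move=> x _; case: (dF x).
  + by apply: cvg_at_right_filter; exact: cF.
  + by apply: cvg_at_left_filter; exact: cF.
- by move=> x _; rewrite derive1E; case: (dF x).
Qed.

Variables m n : nat.
Implicit Types F G : R -> 'M[R[i]]_(m, n).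

Lemma integrable_mx_entire F (a b : R) : entire_mx F -> integrable_mx F a b.
Proof.
move=> hF i j; have [hr hi] := hF i j.
by split; apply: continuous_integrable; apply: entire_continuous.
Qed.

Lemma integral_mx_derive F dF (b : R) : (forall t, is_derive_mx F t (dF t)) ->
  entire_mx dF -> 0 <= b -> integral_mx dF 0 b = F b - F 0.
Proof.
move=> hF hdF b0; apply/matrixP => i j; have [hr hi] := hdF i j.
have Hr := Rintegral_derive (fun s => (hF s i j).1) (entire_continuous hr) b0.
have Hi := Rintegral_derive (fun s => (hF s i j).2) (entire_continuous hi) b0.
by rewrite !mxE Hr Hi; apply: complex_eqP; rewrite /= ?ReD ?ReN ?ImD ?ImN.
Qed.

Lemma eq_integral_mx F G (a b : R) : (forall t, a <= t <= b -> F t = G t) ->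
  integral_mx F a b = integral_mx G a b.
Proof.
move=> h; apply/matrixP => i j; rewrite !mxE; congr (_ +i* _);
  by apply: eq_Rintegral => t; rewrite inE /= in_itv /= => /h ->.
Qed.

Lemma eq_integrable_mx F G (a b : R) : (forall t, a <= t <= b -> F t = G t) ->
  integrable_mx F a b -> integrable_mx G a b.
Proof.
move=> h iF i j; have [hr hi] := iF i j; split;
  [move: hr|move: hi]; apply: eq_integrable => //= t;
  by rewrite inE /= in_itv /= => /h ->.
Qed.

(** A complex scalar mixes the real and imaginary parts on which [integral_mx] is defined; this one
    computation yields the sum, difference and scaling rules. *)
Lemma integral_mxP F G (c : R[i]) (a b : R) : entire_mx F -> entire_mx G ->
  integral_mx (fun t => c *: F t + G t) a b =
  c *: integral_mx F a b + integral_mx G a b.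
Proof.
move=> hF hG; apply/matrixP => i j; rewrite !mxE.
have [Fr Fi] := hF i j; have [Gr Gi] := hG i j.
have int f : entire f -> lebesgue_measure.-integrable `[a, b] (EFin \o (f : R -> R)).
  by move=> /entire_continuous; exact: continuous_integrable.
apply: complex_eqP => /=; rewrite ?ReD ?ImD ?ReM ?ImM /=.
  under eq_Rintegral do rewrite !mxE ReD ReM.
  rewrite RintegralD ?RintegralB ?RintegralZl //; apply: int => //;
    by repeat first [apply: entireB | apply: entireZ].
under eq_Rintegral do rewrite !mxE ImD ImM.
rewrite RintegralD ?RintegralD ?RintegralZl //; apply: int => //;
  by repeat first [apply: entireD | apply: entireZ].
Qed.

Lemma integral_mxD F G (a b : R) : entire_mx F -> entire_mx G ->
  integral_mx (fun t => F t + G t) a b = integral_mx F a b + integral_mx G a b.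
Proof.
by move=> hF hG; rewrite -[X in X + _]scale1r -integral_mxP //;
  under [in RHS]eq_fun do rewrite scale1r.
Qed.

Lemma integral_mxB F G (a b : R) : entire_mx F -> entire_mx G ->
  integral_mx (fun t => F t - G t) a b = integral_mx F a b - integral_mx G a b.
Proof.
move=> hF hG; rewrite addrC -[X in X + _]scaleN1r -integral_mxP //.
by under [in RHS]eq_fun do rewrite scaleN1r addrC.
Qed.

Lemma integral_mxZ F (c : R[i]) (a b : R) : entire_mx F ->
  integral_mx (fun t => c *: F t) a b = c *: integral_mx F a b.
Proof.
move=> hF; have h0 : entire_mx (fun=> 0 : 'M[R[i]]_(m, n)) by exact: entire_mx_cst.
have := integral_mxP c a b hF h0.
have -> : integral_mx (fun=> 0 : 'M[R[i]]_(m, n)) a b = 0.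
  by apply/matrixP => i j; rewrite !mxE /Rintegral /= integral0.
by rewrite addr0; under eq_fun do rewrite addr0.
Qed.

Lemma integral_mx_cst (A : 'M[R[i]]_(m, n)) : integral_mx (fun=> A) 0 1 = A.
Proof.
apply/matrixP => i j; rewrite !mxE; apply: complex_eqP => /=;
by rewrite Rintegral_cst //= lebesgue_measure_itv /= lte01 oppr0 adde0 /= mulr1.
Qed.

End Integration.

(** * Integral representations and the Hilbert-Schmidt norm *)

(** Every term of the expansion contains exactly two generators. *)
Lemma plaqdM_of_scale {K : comPzRingType} (n : nat) (j : 'I_4) (c : K)
    (L1 L2 L3 L4 U1 U2 V3 V4 : 'M[K]_n) :
  plaqdM_of j (c *: L1) (c *: L2) (c *: L3) (c *: L4) U1 U2 V3 V4 =
  (c * c) *: plaqdM_of j L1 L2 L3 L4 U1 U2 V3 V4.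
Proof.
case: j => [[|[|[|[|//]]]] hj]; rewrite /plaqdM_of /=;
  by rewrite -!(scalemxAl, scalemxAr) !scalerA !(scalerDr, scalerN).
Qed.

Lemma plaqdM_scale {R : realType} (N : nat) (j : 'I_4) (c : R[i])
    (B U : 'I_4 -> 'M[R[i]]_N) :
  plaqdM j (fun k => c *: B k) U = (c * c) *: plaqdM j B U.
Proof.
exact: (@plaqdM_of_scale R[i] N j c (B b1) (B b2) (B b3) (B b4)
  (U b1) (U b2) ((U b3)^t*) ((U b4)^t*)).
Qed.

(** * Iterated integrals of a family with known primitives *)

Section Primitives.
Variables (R : realType) (N : nat).
Variables (F dF : 'I_4 -> R -> 'M[R[i]]_N) (L : 'I_4 -> 'M[R[i]]_N).
Hypothesis F_derive : forall j t, is_derive_mx (F j) t (dF j t).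
Hypothesis F_entire : forall j, entire_mx (F j).
Hypothesis dF_entire : forall j, entire_mx (dF j).
Hypothesis F0 : forall j, F j 0 = L j.

Lemma integral_mx_primitive j (t : R) : 0 <= t -> integral_mx (dF j) 0 t = F j t - L j.
Proof. by move=> t0; rewrite (integral_mx_derive (F_derive j)) // F0. Qed.

Lemma add_integral_mx_primitive j (t : R) : 0 <= t -> L j + integral_mx (dF j) 0 t = F j t.
Proof. by move=> /(integral_mx_primitive j) ->; rewrite addrC subrK. Qed.

Lemma integral_mx_add_primitive j :
  integral_mx (fun t => L j + integral_mx (dF j) 0 t) 0 1 = integral_mx (F j) 0 1.
Proof. by apply: eq_integral_mx => t /andP[t0 _]; exact: add_integral_mx_primitive. Qed.

Lemma integral_mx_primitive2 j :
  integral_mx (fun t => integral_mx (dF j) 0 t) 0 1 = integral_mx (F j) 0 1 - L j.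
Proof.
rewrite -[X in _ - X]integral_mx_cst -integral_mxB //; last exact: entire_mx_cst.
by apply: eq_integral_mx => t /andP[t0 _]; exact: integral_mx_primitive.
Qed.

Let K j := integral_mx (fun t => L j + integral_mx (dF j) 0 t) 0 1.
Let K0 j := integral_mx (fun t => integral_mx (dF j) 0 t) 0 1.

Lemma sum_integral_mx : K b1 + K b2 - K b3 - K b4 =
  integral_mx (fun t => F b1 t + F b2 t - F b3 t - F b4 t) 0 1.
Proof.
rewrite /K !integral_mx_add_primitive !integral_mxB ?integral_mxD //.
  exact: entire_mxD.
by apply: entire_mxB => //; exact: entire_mxD.
Qed.

Lemma sum_integral_mx2 : K0 b1 + K0 b2 - K0 b3 - K0 b4 =
  K b1 + K b2 - K b3 - K b4 - circ L.
Proof.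
rewrite /K0 /K /circ !integral_mx_primitive2 !integral_mx_add_primitive.
by apply/matrixP => i j; rewrite !mxE; ring.
Qed.

Variables (c : R[i]) (G : 'I_4 -> R -> 'M[R[i]]_N).
Hypothesis c_neq0 : c != 0.
Hypothesis dFE : forall j t, dF j t = c *: G j t.

(** The inner integral, as a function of $t$ on the whole line, is in general not entire, since it
    vanishes for $t<0$. On $[0,1]$ it is therefore replaced by $c^{-1}(F_j(t)-L_j)$, which is
    entire, before the scalar is moved. *)
Lemma integral_mx_scale2 j :
  K0 j = c *: integral_mx (fun t => integral_mx (G j) 0 t) 0 1.
Proof.
have inner (t : R) : 0 <= t -> integral_mx (G j) 0 t = c^-1 *: (F j t - L j).
  move=> t0; rewrite -integral_mx_primitive // -integral_mxZ //.
  by apply: eq_integral_mx => s _; rewrite dFE scalerA mulVf // scale1r.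
have -> : integral_mx (fun t => integral_mx (G j) 0 t) 0 1 =
    integral_mx (fun t => c^-1 *: (F j t - L j)) 0 1.
  by apply: eq_integral_mx => t /andP[t0 _]; exact: inner.
have eL : entire_mx (fun=> L j) by exact: entire_mx_cst.
rewrite /K0 integral_mx_primitive2 integral_mxZ; last exact: entire_mxB.
by rewrite integral_mxB // integral_mx_cst scalerA divff // scale1r.
Qed.

End Primitives.

Section Representation.
Variables (R : realType) (N : nat).
Variable LL : 'I_4 -> 'M[R[i]]_N.
Hypothesis LL_anti : forall j, (LL j)^t* = - LL j.

Let M j (t : R) := plaqM j LL (flow LL t).
Let dM j (t : R) := plaqdM j LL (flow LL t).

Let M_derive j t : is_derive_mx (M j) t (dM j t) := is_derive_plaqM LL_anti j t.
Let M_entire j : entire_mx (M j) := entire_plaqM LL j LL.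
Let dM_entire j : entire_mx (dM j) := entire_plaqdM LL j LL.
Let M0 j : M j 0 = LL j := plaqM0 LL j.

Lemma rep1E : plaq (flow LL 1) - 1%:M = rep1 LL.
Proof.
have E := integral_mx_derive (is_derive_plaq LL_anti)
  (entire_mxB (entire_mxB (entire_mxD (M_entire b1) (M_entire b2)) (M_entire b3))
    (M_entire b4)) ler01.
by rewrite -(plaq0 LL); exact: esym E.
Qed.

Lemma add_integral_plaqdM j (t : R) : 0 <= t ->
  LL j + integral_mx (dM j) 0 t = plaqM j LL (flow LL t).
Proof. exact: (add_integral_mx_primitive M_derive dM_entire M0). Qed.

Lemma rep2E : rep2 LL = rep1 LL.
Proof. exact: (sum_integral_mx M_derive M_entire dM_entire M0). Qed.

Lemma remainderE : remainder LL LL = rep2 LL - circ LL.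
Proof. exact: (sum_integral_mx2 M_derive M_entire dM_entire M0). Qed.

(** With $c$ proportional to $g$, this extracts $g^2$ from the integral terms; one power survives
    the division by $g$ in the plaquette field. *)
Lemma remainder_scale (c : R[i]) (B : 'I_4 -> 'M[R[i]]_N) :
  c != 0 -> (forall j, LL j = c *: B j) -> remainder LL LL = (c * c) *: remainder B LL.
Proof.
move=> c0 /funext LE.
have cc0 : c * c != 0 by rewrite mulf_neq0.
have dE j t : dM j t = (c * c) *: plaqdM j B (flow LL t).
  (* Only the prefactors are rewritten; the occurrence of [LL] inside [flow] stays. *)
  by rewrite /dM {1}LE; exact: plaqdM_scale.
have h := integral_mx_scale2 M_derive M_entire dM_entire M0 cc0 dE.
have gather (K0 K : 'I_4 -> 'M[R[i]]_N) (a : R[i]) : (forall j, K0 j = a *: K j) ->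
    K0 b1 + K0 b2 - K0 b3 - K0 b4 = a *: (K b1 + K b2 - K b3 - K b4).
  by move=> E; rewrite !E -scalerDr -!scalerBr.
exact: gather h.
Qed.

End Representation.

Section HilbertSchmidt.
Variable R : realType.

Definition sqHS (m n : nat) (A : 'M[R[i]]_(m, n)) : R := complex.Re (\tr (A^t* *m A)).

Lemma Re_tr_adjM (m n : nat) (A B : 'M[R[i]]_(m, n)) :
  complex.Re (\tr (A^t* *m B)) = \sum_i \sum_j
    (complex.Re (A i j) * complex.Re (B i j) + complex.Im (A i j) * complex.Im (B i j)).
Proof.
rewrite /mxtrace Re_sum exchange_big /=; apply: eq_bigr => j _.
rewrite mxE Re_sum; apply: eq_bigr => i _.
by rewrite adjmxE ReM ReJ ImJ mulNr opprK.
Qed.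

Lemma sqHSE (m n : nat) (A : 'M[R[i]]_(m, n)) :
  sqHS A = \sum_i \sum_j (complex.Re (A i j) ^+ 2 + complex.Im (A i j) ^+ 2).
Proof. by rewrite /sqHS Re_tr_adjM. Qed.

Lemma sqHS_ge0 (m n : nat) (A : 'M[R[i]]_(m, n)) : 0 <= sqHS A.
Proof.
by rewrite sqHSE; do 2 (apply: sumr_ge0 => ? _); rewrite addr_ge0 ?sqr_ge0.
Qed.

Lemma sqr_norm_HS (m n : nat) (A : 'M[R[i]]_(m, n)) : norm_HS A ^+ 2 = sqHS A.
Proof. by rewrite sqr_sqrtr ?sqHS_ge0. Qed.

Lemma sqHS0 (m n : nat) : sqHS (0 : 'M[R[i]]_(m, n)) = 0.
Proof. by rewrite /sqHS mulmx0 mxtrace0. Qed.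

Lemma sqHS_eq0 (m n : nat) (A : 'M[R[i]]_(m, n)) : sqHS A = 0 -> A = 0.
Proof.
rewrite sqHSE => A0; apply/matrixP => i j; rewrite mxE.
have ge0 k l : 0 <= complex.Re (A k l) ^+ 2 + complex.Im (A k l) ^+ 2.
  by rewrite addr_ge0 ?sqr_ge0.
have ge0s k : 0 <= \sum_l (complex.Re (A k l) ^+ 2 + complex.Im (A k l) ^+ 2).
  by apply: sumr_ge0.
have /(_ i isT) := psumr_eq0P (fun k _ => ge0s k) A0.
move=> /(psumr_eq0P (fun l _ => ge0 i l)) /(_ j isT) /eqP.
rewrite paddr_eq0 ?sqr_ge0 // !sqrf_eq0 => /andP[/eqP re /eqP im].
exact: complex_eqP.
Qed.

Lemma sqHS_adj (m n : nat) (A : 'M[R[i]]_(m, n)) : sqHS (A^t*) = sqHS A.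
Proof. by rewrite /sqHS trmxCK mxtrace_mulC. Qed.

Lemma sqHS_mulr_unitary (n : nat) (A V : 'M[R[i]]_n) :
  V \is unitarymx -> sqHS (A *m V) = sqHS A.
Proof.
move=> /unitarymxP VV.
by rewrite /sqHS adjmxM mulmxA mxtrace_mulC !mulmxA VV mul1mx.
Qed.

(** This is $|A-B|^2\ge0$, entry by entry. It takes the place of Cauchy-Schwarz both in the
    exponential bound and in the comparison with the operator norm. *)
Lemma Re_tr_adjM_le (m n : nat) (A B : 'M[R[i]]_(m, n)) :
  2 * complex.Re (\tr (A^t* *m B)) <= sqHS A + sqHS B.
Proof.
rewrite Re_tr_adjM !sqHSE mulr_sumr -big_split /=; apply: ler_sum => i _.
rewrite mulr_sumr -big_split /=; apply: ler_sum => j _.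
by have := sqr_ge0 (complex.Re (A i j) - complex.Re (B i j));
   have := sqr_ge0 (complex.Im (A i j) - complex.Im (B i j)); nra.
Qed.

Lemma sqr_sum_le (I : finType) (S : {set I}) (f : I -> R) :
  (\sum_(i in S) f i) ^+ 2 <= #|S|%:R * \sum_(i in S) f i ^+ 2.
Proof.
have h : 0 <= \sum_(i in S) \sum_(j in S) (f i - f j) ^+ 2.
  by do 2 (apply: sumr_ge0 => ? _); exact: sqr_ge0.
(* Lagrange's identity, which exhibits the defect in Cauchy-Schwarz as a sum of squares. *)
suff E : \sum_(i in S) \sum_(j in S) (f i - f j) ^+ 2 =
    2 * (#|S|%:R * \sum_(i in S) f i ^+ 2) - 2 * (\sum_(i in S) f i) ^+ 2 by lra.
under eq_bigr do under eq_bigr do rewrite sqrrB.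
under eq_bigr do rewrite big_split sumrB /= sumr_const.
rewrite big_split sumrB /= sumr_const -sumrMnl.
under [X in _ - X]eq_bigr do rewrite sumrMnl -mulr_sumr.
have -> : \sum_(i in S) f i * (\sum_(i0 in S) f i0) *+ 2 = (\sum_(i in S) f i) ^+ 2 *+ 2.
  by rewrite sumrMnl -mulr_suml.
rewrite sumrMnl; move: (\sum_(i in S) f i) (\sum_(i in S) f i ^+ 2) #|S| => x y k.
by rewrite -[y *+ k]mulr_natl; ring.
Qed.

Lemma sqHS_sum_le (m n : nat) (I : finType) (S : {set I}) (A : I -> 'M[R[i]]_(m, n)) :
  sqHS (\sum_(i in S) A i) <= #|S|%:R * \sum_(i in S) sqHS (A i).
Proof.
rewrite sqHSE; under [X in _ * X]eq_bigr do rewrite sqHSE.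
rewrite [X in _ <= _ * X]exchange_big mulr_sumr /=; apply: ler_sum => i _.
rewrite [X in _ <= _ * X]exchange_big mulr_sumr /=; apply: ler_sum => j _.
by rewrite big_split mulrDr summxE Re_sum Im_sum lerD // sqr_sum_le.
Qed.

End HilbertSchmidt.

(** * The quadratic bound for one plaquette *)

Section PlaquetteAction.
Variables (R : realType) (N : nat).
Implicit Types U : 'M[R[i]]_N.

Lemma Re_tr_adj U : complex.Re (\tr (U^t*)) = complex.Re (\tr U).
Proof.
by rewrite /mxtrace !Re_sum; apply: eq_bigr => i _; rewrite adjmxE ReJ.
Qed.

Lemma Re_trD U V : complex.Re (\tr (U + V)) = complex.Re (\tr U) + complex.Re (\tr V).
Proof. by rewrite mxtraceD ReD. Qed.

Lemma Re_trN U : complex.Re (\tr (- U)) = - complex.Re (\tr U).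
Proof. by rewrite raddfN ReN. Qed.

(** By unitarity $(U-1)^\dagger(U-1)=2-U-U^\dagger$, and $U$, $U^\dagger$ have traces with equal
    real parts. *)
Lemma action_sqHS U : U \is unitarymx -> action U = sqHS (U - 1%:M).
Proof.
move=> /unitarymxP UU; rewrite /action /sqHS adjmxD adjmxN adjmx1.
rewrite mulmxDl mulNmx mul1mx mulmxDr mulmxN mulmx1 (mulmx1C UU).
by rewrite !Re_trD !Re_trN !Re_trD !Re_trN Re_tr_adj; ring.
Qed.

Lemma unitary_adj U : U \is unitarymx -> U^t* \is unitarymx.
Proof. by rewrite trmxC_unitary. Qed.

Lemma plaq_unitary (U : 'I_4 -> 'M[R[i]]_N) :
  (forall j, U j \is unitarymx) -> plaq U \is unitarymx.
Proof.
by move=> h; rewrite /plaq !mul_unitarymx // trmxC_unitary.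
Qed.

(* [U_p - 1] telescopes into these four terms, each a unitary multiple of
   [U_j - 1] or of its adjoint. *)
Definition plaq_tele (U : 'I_4 -> 'M[R[i]]_N) (j : 'I_4) : 'M[R[i]]_N :=
  nth 0 [:: (U b1 - 1%:M) *m (U b2 *m (U b3)^t* *m (U b4)^t*);
            (U b2 - 1%:M) *m ((U b3)^t* *m (U b4)^t*);
            (U b3 - 1%:M)^t* *m (U b4)^t*; (U b4 - 1%:M)^t*] j.

Lemma sum_plaq_tele (U : 'I_4 -> 'M[R[i]]_N) :
  plaq U - 1%:M = \sum_j plaq_tele U j.
Proof.
rewrite !big_ord_recl big_ord0 /plaq_tele /= !adjmxD !adjmxN adjmx1 /plaq.
rewrite !mulmxDl !mulNmx !mul1mx !mulmxA addr0.
by rewrite !addrA !subrK.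
Qed.

Lemma sqHS_plaq_tele (U : 'I_4 -> 'M[R[i]]_N) (j : 'I_4) :
  (forall k, U k \is unitarymx) -> sqHS (plaq_tele U j) = sqHS (U j - 1%:M).
Proof.
move=> h; have hV k : (U k)^t* \is unitarymx by exact: unitary_adj.
have hb k : j = k -> sqHS (U k - 1%:M) = sqHS (U j - 1%:M) by move=> ->.
case: j hb => [[|[|[|[|//]]]] hj] hb; rewrite /plaq_tele /=.
- by rewrite sqHS_mulr_unitary; [apply/hb/val_inj | rewrite !mul_unitarymx].
- by rewrite sqHS_mulr_unitary; [apply/hb/val_inj | rewrite mul_unitarymx].
- by rewrite sqHS_mulr_unitary // sqHS_adj; apply/hb/val_inj.
- by rewrite sqHS_adj; apply/hb/val_inj.
Qed.

(** A telescoping term off [S] has norm $|1-1|=0$, so Cauchy-Schwarz runs over [S] alone. This is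
    the origin of the factors $1,2,3,4$. *)
Lemma action_plaq_le (U : 'I_4 -> 'M[R[i]]_N) (S : {set 'I_4}) :
  (forall j, U j \is unitarymx) -> (forall j, j \notin S -> U j = 1%:M) ->
  action (plaq U) <= #|S|%:R * \sum_(j in S) action (U j).
Proof.
move=> h hS; rewrite action_sqHS ?sum_plaq_tele; last exact: plaq_unitary.
have -> : \sum_j plaq_tele U j = \sum_(j in S) plaq_tele U j.
  rewrite [LHS](bigID (mem S)) /= [X in _ + X]big1 ?addr0 // => j jS.
  have := sqHS_plaq_tele j h; rewrite hS // subrr sqHS0 => /sqHS_eq0.
  exact.
apply: le_trans (sqHS_sum_le _ _) _.
rewrite ler_wpM2l //; apply: ler_sum => j _.
by rewrite sqHS_plaq_tele // action_sqHS.
Qed.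

Lemma is_derive_Re_tr (F : R -> 'M[R[i]]_N) (t : R) dF : is_derive_mx F t dF ->
  is_derive t (1 : R) (fun s => complex.Re (\tr (F s))) (complex.Re (\tr dF)).
Proof.
move=> h; rewrite /mxtrace Re_sum; under eq_fun do rewrite Re_sum.
by apply: is_derive_bigsum => i; case: (h i i).
Qed.

Lemma ge0_derive_ge0 (f df : R -> R) (x : R) :
  (forall t, is_derive t (1 : R) f (df t)) -> (forall t, 0 <= t -> 0 <= df t) ->
  0 <= x -> f 0 <= f x.
Proof.
move=> hf df0 x0; apply: (@ger0_derive1_ndecry R f 0) => //.
- move=> t; rewrite in_itv /= andbT => t0.
  by have [_ e] := hf t; rewrite derive1E e; apply/df0/ltW.
- apply: continuous_subspaceT => t.
  by apply/differentiable_continuous/derivable1_diffP; case: (hf t).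
Qed.

Lemma Re_tr_antiadj (L : 'M[R[i]]_N) : L^t* = - L -> complex.Re (\tr L) = 0.
Proof. by move=> hL; have := Re_tr_adj L; rewrite hL Re_trN; move: (complex.Re _) => x; lra. Qed.

(* [f(t) = action (e^{tL})] has [f(0) = f'(0) = 0] and
   [f''(t) = 2 Re Tr (L^* L e^{tL}) <= 2 |L|^2]. *)
Lemma action_expmx_le (L : 'M[R[i]]_N) : L^t* = - L -> action (expmx L) <= sqHS L.
Proof.
move=> hL.
have arith1 (t x y : R) : 0 <= x + t * y -> 0 <= 2 * x + 2 * t * y by move=> h; lra.
have arith2 (x y : R) : 2 * - x <= y + y -> - y <= x by move=> h; lra.
have arith3 (x y : R) : - y <= x -> 0 <= x + y by move=> h; lra.
have arith4 (x y z : R) : 2 * x + 0 * 0 * y <= 2 * z + 1 * 1 * y -> 2 * (x - z) <= y.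
  by move=> h; lra.
pose E (t : R) := expmx (t%:C *: L).
(* The local [f] is the real trace itself, so the action of $e^{tL}$ is $2(f(0)-f(t))$ and the
   second-derivative bound becomes a lower bound on [f2]. *)
pose f t := complex.Re (\tr (E t)); pose f1 t := complex.Re (\tr (L *m E t)).
pose f2 t := complex.Re (\tr (L *m (L *m E t))).
have d0 t : is_derive t (1 : R) f (f1 t).
  by apply: is_derive_Re_tr; exact: is_derive_expmx.
have d1 t : is_derive t (1 : R) f1 (f2 t).
  apply: is_derive_Re_tr.
  have := is_derive_mxM (is_derive_mx_cst L t) (is_derive_expmx L t).
  by apply: eq_is_derive_mx => //; rewrite mul0mx add0r.
have f2_ge t : - sqHS L <= f2 t.
  have := Re_tr_adjM_le L (L *m E t).
  rewrite hL mulNmx Re_trN sqHS_mulr_unitary -/(f2 t).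
    exact: arith2.
  by apply: expmx_unitary; exact: antiadj_scale.
have f10 : f1 0 = 0.
  by rewrite /f1 /E scale0r expmx0 mulmx1 Re_tr_antiadj.
(* The inequality is integrated twice: here [f1 s + s * sqHS L] is nondecreasing from the value $0$,
   and then so is [2 * f s + s * s * sqHS L] from its value at $0$. *)
have g1_ge0 (t : R) : 0 <= t -> 0 <= 2 * f1 t + 2 * t * sqHS L.
  move=> t0; have := @ge0_derive_ge0 (fun s => f1 s + s * sqHS L) (fun s => f2 s + sqHS L) t.
  rewrite /= f10 mul0r addr0 => h.
  apply/arith1/h => // [s|s _]; last exact: arith3.
  have := is_deriveD (d1 s) (is_derive_mul (is_derive_id s 1) (is_derive_cst (sqHS L) s 1)).
  by rewrite mul1r mulr0 addr0.
have dg s : is_derive s (1 : R) (fun s => 2 * f s + s * s * sqHS L)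
    (2 * f1 s + 2 * s * sqHS L).
  have := is_deriveD (is_derive_mul (is_derive_cst (2 : R) s 1) (d0 s))
    (is_derive_mul (is_derive_mul (is_derive_id s 1) (is_derive_id s 1))
      (is_derive_cst (sqHS L) s 1)).
  congr (is_derive _ _ _ _).
  by rewrite /cst; move: (f s) (f1 s) (sqHS L) => x y z; ring.
have := ge0_derive_ge0 dg g1_ge0 ler01; rewrite /f /E scale1r scale0r expmx0 => h.
by rewrite /action Re_trD Re_trN; exact: arith4.
Qed.

End PlaquetteAction.

(** * Lie algebra coordinates and lattice sums *)

Section LieAlgebra.
Variables (R : realType) (N : nat) (theta : 'I_(N ^ 2) -> 'M[R[i]]_N).
Hypothesis theta_basis : selfadjoint_basis theta.
Implicit Types x : 'I_(N ^ 2) -> R.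

Lemma hermsymmx_adj (A : 'M[R[i]]_N) : A \is hermsymmx -> A^t* = A.
Proof. by move/is_hermitianmxP; rewrite expr0 scale1r => {2}->. Qed.

Lemma selfadj_adj x : (selfadj theta x)^t* = selfadj theta x.
Proof.
have [th _ _] := theta_basis.
rewrite /selfadj raddf_sum map_mx_sum; apply: eq_bigr => k _.
by rewrite adjmxZ conjc_real hermsymmx_adj.
Qed.

Lemma ilie_anti (c : R) x : (ilie theta c x)^t* = - ilie theta c x.
Proof.
rewrite /ilie adjmxZ selfadj_adj -scaleNr; congr (_ *: _).
by apply: complex_eqP; rewrite /=; ring.
Qed.

Lemma tr_selfadj_sqr x :
  \tr (selfadj theta x *m selfadj theta x) = (sqnorm x)%:C.
Proof.
have [_ th _] := theta_basis.
rewrite {1}/selfadj mulmx_suml raddf_sum /sqnorm rmorph_sum /=.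
apply: eq_bigr => k _; rewrite -scalemxAl mxtraceZ /selfadj mulmx_sumr raddf_sum.
rewrite (bigD1 k) //= big1 => [|l lk].
  rewrite addr0 -scalemxAr mxtraceZ th eqxx mulr1 real_normK ?num_real //.
  by rewrite -rmorphM expr2.
by rewrite -scalemxAr mxtraceZ th eq_sym (negbTE lk) mulr0.
Qed.

Lemma sqHS_ilie (c : R) x : sqHS (ilie theta c x) = c ^+ 2 * sqnorm x.
Proof.
rewrite /sqHS ilie_anti mulNmx {1 2}/ilie -scalemxAl -scalemxAr scalerA.
rewrite -scaleNr mxtraceZ tr_selfadj_sqr /=; move: (sqnorm x) => y; ring.
Qed.

Lemma coordE x k : (x k)%:C = - 'i%C * \tr (theta k *m ilie theta 1 x).
Proof.
have [_ th _] := theta_basis.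
rewrite /ilie -scalemxAr mxtraceZ /selfadj mulmx_sumr raddf_sum (bigD1 k) //= big1 => [|l lk].
  rewrite addr0 -scalemxAr mxtraceZ th eqxx mulr1.
  by apply: complex_eqP; rewrite /=; ring.
by rewrite -scalemxAr mxtraceZ th eq_sym (negbTE lk) mulr0.
Qed.

Lemma ilieM (g c : R) x : ilie theta (g * c) x = g%:C *: ilie theta c x.
Proof. by rewrite /ilie scalerA rmorphM /= mulrCA. Qed.

Lemma selfadj_scale (k : R) x : selfadj theta (fun i => k * x i) = k%:C *: selfadj theta x.
Proof.
rewrite /selfadj scaler_sumr; apply: eq_bigr => i _.
by rewrite rmorphM scalerA.
Qed.

(** The coupling becomes the flow time, so entire functions of the time are entire functions of
    $g$. *)
Lemma flow_ilie (c g : R) (x : 'I_4 -> 'I_(N ^ 2) -> R) :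
  (fun j => expmx (ilie theta (g * c) (x j))) = flow (fun j => ilie theta c (x j)) g.
Proof. by apply/funext => j; rewrite ilieM. Qed.

Lemma action_ilie_le (c : R) x :
  action (expmx (ilie theta c x)) <= c ^+ 2 * sqnorm x.
Proof. by rewrite -sqHS_ilie; apply: action_expmx_le; exact: ilie_anti. Qed.

Lemma sqnorm_ge0 (n : nat) (y : 'I_n -> R) : 0 <= sqnorm y.
Proof. by apply: sumr_ge0 => i _; rewrite exprn_ge0. Qed.

(** The map [b] is the identity for an isolated plaquette and [plaq_bond p] on the lattice. *)
Lemma action_retain_le (I : finType) (S : {set I}) (b : 'I_4 -> I) (c : R)
    (U : I -> 'M[R[i]]_N) (x : I -> 'I_(N ^ 2) -> R) :
  (forall i, i \in S -> U i = expmx (ilie theta c (x i))) ->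
  action (plaq (fun j => retain S U (b j))) <=
  #|[set j | b j \in S]%SET|%:R * \sum_(j | b j \in S) (c ^+ 2 * sqnorm (x (b j))).
Proof.
move=> hU; have -> : \sum_(j | b j \in S) (c ^+ 2 * sqnorm (x (b j))) =
    \sum_(j in [set j | b j \in S]%SET) (c ^+ 2 * sqnorm (x (b j))).
  by apply: eq_bigl => j; rewrite inE.
apply: le_trans (action_plaq_le (S := [set j | b j \in S]%SET) _ _) _.
- move=> j; rewrite /retain; case: ifP => [/hU ->|_].
    by apply: expmx_unitary; exact: ilie_anti.
  by apply/unitarymxP; rewrite adjmx1 mulmx1.
- by move=> j; rewrite inE /retain => /negbTE ->.
rewrite ler_wpM2l //; apply: ler_sum => j; rewrite inE => jS.
by rewrite /retain jS hU // action_ilie_le.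
Qed.

End LieAlgebra.

Section OperatorNorm.
Variables (R : realType) (N : nat).

(* [0 <= |M - (Mv) v^*|^2 = |M|^2 - 2 |Mv|^2 + |Mv|^2 |v|^2]. *)
Lemma sqHS_mulmx_le (M : 'M[R[i]]_N) (v : 'cV[R[i]]_N) :
  sqHS v <= 1 -> sqHS (M *m v) <= sqHS M.
Proof.
move=> v1; have := Re_tr_adjM_le M (M *m v *m v^t*).
have -> : \tr (M^t* *m (M *m v *m v^t*)) = \tr ((M *m v)^t* *m (M *m v)).
  by rewrite adjmxM mulmxA mxtrace_mulC !mulmxA.
have -> : sqHS (M *m v *m v^t*) = sqHS (M *m v) * sqHS v.
  rewrite !sqHSE mulr_suml; apply: eq_bigr => i _; rewrite big_ord1 mulr_sumr.
  apply: eq_bigr => j _; rewrite big_ord1 [(_ *m v^t*) i j]mxE big_ord1.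
  by rewrite adjmxE ReM ImM ReJ ImJ; ring.
rewrite -/(sqHS _); have := sqHS_ge0 (M *m v).
by move: (sqHS _) (sqHS _) (sqHS _) v1 => x y z y1 z0; nra.
Qed.

Lemma norm_op_le_HS (M : 'M[R[i]]_N) : norm_op M <= norm_HS M.
Proof.
apply: ge_sup.
  exists (norm_HS (M *m (0 : 'cV_N))); exists 0 => //=.
  by rewrite /norm_HS -/(sqHS _) sqHS0 sqrtr0.
move=> _ [v /= v1 <-]; rewrite ler_wsqrtr //; apply: sqHS_mulmx_le.
have := lexx (sqHS v); rewrite -sqr_norm_HS => /le_trans; apply.
by rewrite expr_le1 // sqrtr_ge0.
Qed.

End OperatorNorm.

(** * Eigenvalues and Lie algebra coordinates *)

Lemma char_poly_conj {F : fieldType} (n : nat) (A P : 'M[F]_n) : P \in unitmx ->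
  char_poly (invmx P *m A *m P) = char_poly A.
Proof.
move=> Pu; rewrite /char_poly /char_poly_mx.
pose Q := map_mx polyC P; pose Qi := map_mx polyC (invmx P).
have QQ : Qi *m Q = 1%:M by rewrite -map_mxM mulVmx // map_mx1.
have -> : 'X%:M - map_mx polyC (invmx P *m A *m P) = Qi *m ('X%:M - map_mx polyC A) *m Q.
  rewrite mulmxBr mulmxBl !map_mxM; congr (_ - _).
  by rewrite mul_mx_scalar -scalemxAl QQ scalemx1.
by rewrite !det_mulmx mulrAC -det_mulmx QQ det1 mul1r.
Qed.

(** A self-adjoint matrix is normal, hence diagonalisable. Its diagonal and [lam] split the same
    polynomial, so they agree up to a permutation, which a sum of squares does not see. *)
Lemma tr_sqr_char_poly {C : numClosedFieldType} (n : nat) (A : 'M[C]_n) (lam : 'I_n -> C) :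
  A^t* = A -> char_poly A = \prod_k ('X - (lam k)%:P) ->
  \tr (A *m A) = \sum_k lam k ^+ 2.
Proof.
move=> Aadj cA.
have /orthomx_spectralP AE : A \is normalmx by apply/normalmxP; rewrite Aadj.
have Pu := spectral_unit A.
move: (spectralmx A) (spectral_diag A) AE Pu => P s AE Pu.
have : \prod_(x <- map (fun k => s 0 k) (index_enum 'I_n)) ('X - x%:P) =
    \prod_(x <- map lam (index_enum 'I_n)) ('X - x%:P).
  rewrite !big_map -cA AE char_poly_conj // char_poly_trig ?diag_mx_is_trig //.
  by apply: eq_bigr => k _; rewrite mxE eqxx.
move=> /prod_XsubC_eq h.
have -> : \sum_k lam k ^+ 2 = \sum_(x <- map lam (index_enum 'I_n)) x ^+ 2.
  by rewrite big_map.
rewrite -(perm_big _ h) /= big_map AE !mulmxA mulmxK // mxtrace_mulC !mulmxA.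
rewrite mulmxV // mul1mx mulmx_diag mxtrace_diag.
by apply: eq_bigr => k _; rewrite mxE expr2.
Qed.

(** Both sides are the trace of the squared matrix, by orthonormality of the basis and by its
    eigenvalues respectively. *)
Lemma sqnorm_char_poly {R : realType} (N : nat) (theta : 'I_(N ^ 2) -> 'M[R[i]]_N)
    (x : 'I_(N ^ 2) -> R) (lam : 'I_N -> R) : selfadjoint_basis theta ->
  char_poly (selfadj theta x) = \prod_k ('X - ((lam k)%:C)%:P) -> sqnorm x = sqnorm lam.
Proof.
move=> hth cp; apply: (@complexI R); rewrite -(tr_selfadj_sqr hth).
rewrite (tr_sqr_char_poly (selfadj_adj hth x) cp) /sqnorm rmorph_sum /=.
by apply: eq_bigr => k _; rewrite real_normK ?num_real // rmorphXn.
Qed.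

(** * Counting the plaquettes through a bond *)

Section LatticeCount.
Variables (R : realType) (d L : nat).

Lemma shift_inj (mu : 'I_d) : injective (fun x : site d L => Defs.shift x mu).
Proof.
move=> x y /ffunP h; apply/ffunP => nu; have := h nu; rewrite !ffunE.
by case: ifP => // _; exact: ordS_inj.
Qed.

(** Either boundary condition is enlarged to all triples with [mu < nu], where cyclic shifts permute
    the sites. A coordinate plane then contributes [2 * (g mu + g nu)], the $2$ coming from parallel
    bonds, and each direction lies in $d-1$ planes. *)
Lemma sum_plaq_bond (f : bond d L -> R) (bc : boundary) : (forall b, 0 <= f b) ->
  \sum_(p in plaquettes bc) \sum_j f (plaq_bond p j) <=
  2 * (d%:R - 1) * \sum_b f b.
Proof.
move=> f0; pose g mu := \sum_x f (x, mu).
have le1 : \sum_(p in plaquettes bc) \sum_j f (plaq_bond p j) <=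
    \sum_(p : site d L * 'I_d * 'I_d | (p.1.2 < p.2)%N) \sum_j f (plaq_bond p j).
  rewrite [leRHS](bigID (mem (plaquettes bc))) /=.
  rewrite [X in _ <= X + _](eq_bigl (mem (plaquettes bc))).
    by rewrite lerDl; do 2 (apply: sumr_ge0 => ? _).
  by move=> p; rewrite !inE; case: ltnP.
apply: le_trans le1 _.
have -> : \sum_(p : site d L * 'I_d * 'I_d | (p.1.2 < p.2)%N) \sum_j f (plaq_bond p j) =
    \sum_(mu < d) \sum_(nu < d | (mu < nu)%N) 2 * (g mu + g nu).
  transitivity (\sum_(x : site d L) \sum_(mu < d) \sum_(nu < d | (mu < nu)%N)
      (f (x, mu) + f (Defs.shift x mu, nu) + f (Defs.shift x nu, mu) + f (x, nu))).
    pose H x mu nu :=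
      f (x, mu) + f (Defs.shift x mu, nu) + f (Defs.shift x nu, mu) + f (x, nu).
    rewrite (pair_bigA _ (fun (x : site d L) (mu : 'I_d) =>
      \sum_(nu < d | (mu < nu)%N) H x mu nu)) /=.
    rewrite (pair_big_dep xpredT (fun (q : site d L * 'I_d) (nu : 'I_d) => (q.2 < nu)%N)
      (fun q nu => H q.1 q.2 nu)) /=.
    apply: eq_bigr => -[[x mu] nu] _.
    by rewrite !big_ord_recl big_ord0 /= addr0 !addrA.
  rewrite exchange_big /=; apply: eq_bigr => mu _.
  rewrite exchange_big /=; apply: eq_bigr => nu _.
  rewrite !big_split /= -/(g mu) -/(g nu).
  have e m n : \sum_i f (Defs.shift i m, n) = g n.
    by rewrite /g [RHS](reindex_inj (@shift_inj m)).
  by rewrite !e; ring.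
have -> : \sum_b f b = \sum_mu g mu.
  by rewrite exchange_big pair_big /=; apply: eq_bigr => -[].
(* Exchanging the two directions lets the ordered pairs be recombined into all [nu != mu], with
   summand [g mu]. *)
have swap : \sum_(mu < d) \sum_(nu < d | (mu < nu)%N) g nu =
    \sum_(mu < d) \sum_(nu < d | (nu < mu)%N) g mu.
  by rewrite (exchange_big_dep xpredT).
have -> : \sum_(mu < d) \sum_(nu < d | (mu < nu)%N) 2 * (g mu + g nu) =
    2 * \sum_(mu < d) \sum_(nu < d | nu != mu) g mu.
  rewrite mulr_sumr.
  transitivity (2 * (\sum_(mu < d) \sum_(nu < d | (mu < nu)%N) g mu +
      \sum_(mu < d) \sum_(nu < d | (mu < nu)%N) g nu)).
    rewrite -big_split mulr_sumr; apply: eq_bigr => mu _.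
    by rewrite -big_split mulr_sumr.
  rewrite swap -big_split mulr_sumr; apply: eq_bigr => mu _; congr (_ * _).
  rewrite [RHS](bigID (fun nu : 'I_d => (mu < nu)%N)) /=; congr (_ + _); apply: eq_bigl => nu.
    by rewrite -val_eqE /=; case: (ltngtP (nu : nat) mu).
  by rewrite -val_eqE /=; case: (ltngtP (nu : nat) mu).
rewrite -mulrA ler_wpM2l // mulr_sumr; apply: ler_sum => mu _.
have d0 : (0 < d)%N by exact: leq_trans (ltn_ord mu).
rewrite (eq_bigl (mem (predC1 mu))) // sumr_const cardC1 card_ord.
have -> : d%:R - 1 = d.-1%:R :> R by rewrite -{1}(prednK d0) -natr1 addrK.
by rewrite mulr_natl.
Qed.

End LatticeCount.

(** * Regularity in the coupling *)

Section Regularity.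
Variable R : realType.

Lemma entire_regular (f : R -> R) : entire f -> regular_in_g f.
Proof. by move=> [c hc]; exists c => g _; exact: hc. Qed.

(** The bound gives $f(0)=0$; the quotient $h=f/x$ then satisfies $0\le h(x)\le Kx$ for $x>0$, so
    $h(0)=0$ by continuity and a second division is possible. *)
Lemma entire_div_sqr (f : R -> R) (K : R) : entire f ->
  (forall x, 0 <= f x <= K * x ^+ 2) -> exists2 h, entire h & forall x, f x = x ^+ 2 * h x.
Proof.
move=> ef fK.
have f0 : f 0 = 0.
  by apply/eqP; rewrite eq_le andbC; have := fK 0; rewrite expr0n mulr0.
have [h eh fE] := entire_div ef f0.
have ch : continuous (fun x => h x - K * x).
  by apply: entire_continuous; apply: entireB => //; apply: entireZ; exact: entire_id.
have h0 : h 0 = 0.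
  apply/eqP; rewrite eq_le; apply/andP; split.
    have := continuous_le_right (B := 0) ch; rewrite mulr0 subr0; apply => x x0.
    rewrite subr_le0 -(ler_pM2l x0) -fE mulrCA -expr2.
    by case/andP: (fK x).
  rewrite -oppr_le0.
  apply: (continuous_le_right (h := fun x => - h x)).
    by apply: entire_continuous; apply: entireN.
  move=> x x0; rewrite oppr_le0 -(pmulr_rge0 _ x0) -fE.
  by case/andP: (fK x).
have [h2 eh2 hE] := entire_div eh h0.
by exists h2 => // x; rewrite fE hE mulrA expr2.
Qed.

(* [E (g ^ 2) = k f(g) / g ^ 2] for [g > 0] is extended to [g = 0] by continuity. *)
Lemma regular_energy (f : R -> R) (k K : R) : 0 <= k -> entire f ->
  (forall x, 0 <= f x <= K * x ^+ 2) ->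
  exists E : R -> R,
    [/\ forall g, 0 < g -> E (g ^+ 2) = k / g ^+ 2 * f g,
        regular_in_g2 E & forall s, 0 <= s -> E s <= k * K].
Proof.
move=> k0 ef fK; have [h eh fE] := entire_div_sqr ef fK.
have ch := entire_continuous eh.
have ekh : entire (fun x => k * h x) by exact: entireZ.
(* The quotient may contain odd powers of $g$, hence the square root; its continuity gives
   continuity in $s$ up to $0$. *)
exists (fun s => k * h (Num.sqrt s)); split.
- move=> g g0; rewrite sqrtr_sqr gtr0_norm // fE.
  by field; rewrite gt_eqF.
- split.
    apply: continuous_subspaceT => s.
    apply: (@continuous_comp _ _ _ Num.sqrt (fun x => k * h x)).
      exact: sqrt_continuous.
    exact: entire_continuous.
  have [c hc] := ekh; exists c => g g0.
  by rewrite sqrtr_sqr ger0_norm.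
- have hK x : 0 < x -> h x <= K.
    move=> x0; have /andP[_] := fK x.
    by rewrite fE mulrC ler_pM2r // exprn_gt0.
  move=> s s0; apply: ler_wpM2l => //.
  have := sqrtr_ge0 s; rewrite le_eqVlt => /predU1P[<-|]; last exact: hK.
  exact: continuous_le_right.
Qed.

Lemma entire_quotient (f : R -> R) : entire f -> f 0 = 0 -> forall k : R,
  exists h : R -> R, regular_in_g h /\ forall g, 0 < g -> h g = k * (g^-1 * f g).
Proof.
move=> ef f0 k; have [h eh fE] := entire_div ef f0.
exists (fun g => k * h g); split; first by apply: entire_regular; exact: entireZ.
by move=> g g0; rewrite fE mulKf // gt_eqF.
Qed.

End Regularity.

Section PlaquetteEnergy.
Variables (R : realType) (N d : nat) (a : R) (theta : 'I_(N ^ 2) -> 'M[R[i]]_N).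
Hypotheses (N_gt0 : (0 < N)%N) (theta_basis : selfadjoint_basis theta).

Lemma natr_ge1 : 1 <= N%:R :> R.
Proof. by rewrite ler1n. Qed.

Lemma sqr_C_plaq : C_plaq R N ^+ 2 = 4 * N%:R.
Proof. by rewrite /C_plaq exprMn sqr_sqrtr ?ler0n //; ring. Qed.

Variables (c : R) (x : 'I_4 -> 'I_(N ^ 2) -> R).
Let U (g : R) (j : 'I_4) := expmx (ilie theta (g * c) (x j)).
Let sq := \sum_j sqnorm (x j).

Lemma action_plaq_retain_le (g : R) (S : {set 'I_4}) :
  action (plaq (retain S (U g))) <=
  #|S|%:R * N%:R * ((g * c) ^+ 2 * \sum_(j in S) sqnorm (x j)).
Proof.
have := @action_retain_le R N theta theta_basis _ S id (g * c) (U g) x (fun _ _ => erefl).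
have -> : [set j | id j \in S]%SET = S by apply/setP => j; rewrite inE.
rewrite -mulr_sumr => /le_trans; apply.
have p0 : 0 <= (g * c) ^+ 2 * \sum_(j in S) sqnorm (x j).
  by rewrite mulr_ge0 ?sqr_ge0 // sumr_ge0 // => j _; exact: sqnorm_ge0.
(* The count of retained bonds is already a valid constant; $1\le N$ brings in the stated factor. *)
by rewrite -mulrA ler_wpM2l // ler_peMl // natr_ge1.
Qed.

Lemma action_plaq_ilie_le (g : R) :
  action (plaq (U g)) <= C_plaq R N ^+ 2 * ((g * c) ^+ 2 * sq).
Proof.
have := action_plaq_retain_le g [set: 'I_4]%SET; rewrite cardsT card_ord sqr_C_plaq.
have -> : retain [set: 'I_4]%SET (U g) = U g by apply/funext => j; rewrite /retain inE.
by under eq_bigl do rewrite inE.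
Qed.

Lemma action_plaq_ilie_ge0 (g : R) : 0 <= action (plaq (U g)).
Proof.
rewrite action_sqHS ?sqHS_ge0 //; apply: plaq_unitary => j.
by apply: expmx_unitary; exact: ilie_anti.
Qed.

Lemma entire_action : entire (fun g => action (plaq (U g))).
Proof.
pose L j := ilie theta c (x j).
have -> : (fun g => action (plaq (U g))) =
    (fun g => 2 * (complex.Re (\tr (1%:M : 'M[R[i]]_N)) - complex.Re (\tr (plaq (flow L g))))).
  by apply/funext => g; rewrite /action Re_trD Re_trN /U flow_ilie.
have [h _] := entire_mx_tr (entire_plaq L).
exact: entireZ (entireB (entire_cst _) h).
Qed.

(** Both parametrizations are instances: $c=a$ gives $m=a^{d-2}$, and $c=a^{(4-d)/2}$ gives
    $m=1$. *)
Lemma plaquette_energy (m : R) : a `^ (d%:R - 4) * c ^+ 2 = m ->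
  [/\ (forall g, 0 < g -> energy d a g (plaq (U g)) <= C_plaq R N ^+ 2 * m * sq),
      (forall g (S : {set 'I_4}), 0 < g -> (1 <= #|S| <= 3)%N ->
        energy d a g (plaq (retain S (U g))) <=
          #|S|%:R * N%:R * m * \sum_(j in S) sqnorm (x j))
    & exists E : R -> R,
        [/\ (forall g, 0 < g -> E (g ^+ 2) = energy d a g (plaq (U g))),
            regular_in_g2 E
          & forall s, 0 <= s -> E s <= C_plaq R N ^+ 2 * m * sq]].
Proof.
move=> hm; have k0 : 0 <= a `^ (d%:R - 4) by exact: powR_ge0.
have le (g A B s : R) : 0 < g -> A <= B * ((g * c) ^+ 2 * s) ->
    a `^ (d%:R - 4) / g ^+ 2 * A <= B * m * s.
  move=> g0 AB; have g2 : 0 < g ^+ 2 by rewrite exprn_gt0.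
  apply: le_trans (_ : a `^ (d%:R - 4) / g ^+ 2 * (B * ((g * c) ^+ 2 * s)) <= _).
    by rewrite ler_wpM2l // divr_ge0 // ltW.
  rewrite -hm; move: (_ `^ _) => k; rewrite le_eqVlt; apply/orP; left; apply/eqP.
  by field; rewrite gt_eqF.
split.
- by move=> g g0; apply: le => //; exact: action_plaq_ilie_le.
- by move=> g S g0 _; apply: le => //; exact: action_plaq_retain_le.
have [|E [E1 E2 E3]] := regular_energy (K := C_plaq R N ^+ 2 * (c ^+ 2 * sq)) k0 entire_action.
  move=> g; rewrite action_plaq_ilie_ge0 /=; apply: le_trans (action_plaq_ilie_le g) _.
  by rewrite [leLHS](_ : _ = C_plaq R N ^+ 2 * (c ^+ 2 * sq) * g ^+ 2) //;
    move: (C_plaq R N ^+ 2) (sq) => C s; ring.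
exists E; split => // s s0; apply: le_trans (E3 s s0) _.
by rewrite -hm mulrCA !mulrA.
Qed.

End PlaquetteEnergy.

(** * Plaquette fields and the total action *)

Section PlaquetteIdentities.
Variables (R : realType) (N : nat) (LL : 'I_4 -> 'M[R[i]]_N).
Hypothesis LL_anti : forall j, (LL j)^t* = - LL j.
Let Up := plaq (fun j => expmx (LL j)).

Lemma flow1 : flow LL 1 = (fun j => expmx (LL j)).
Proof. by apply/funext => j; rewrite /flow scale1r. Qed.

Lemma plaq_rep1 : Up - 1%:M = rep1 LL.
Proof. by rewrite /Up -flow1; exact: rep1E. Qed.

Lemma plaq_rep2 : Up - 1%:M = rep2 LL.
Proof. by rewrite rep2E // plaq_rep1. Qed.

Lemma plaq_remainder : Up - 1%:M = circ LL + remainder LL LL.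
Proof. by rewrite remainderE // plaq_rep2 addrC subrK. Qed.

Lemma Re_tr_circ : complex.Re (\tr (circ LL)) = 0.
Proof.
by rewrite /circ !Re_trD !Re_trN !Re_tr_antiadj // !subr0 addr0.
Qed.

Lemma action_remainder : action Up = - (2 * complex.Re (\tr (remainder LL LL))).
Proof.
rewrite /action -opprB Re_trN mulrN plaq_remainder Re_trD Re_tr_circ.
by rewrite add0r.
Qed.

Lemma action_norm : action Up = `|2 * complex.Re (\tr (Up - 1%:M))|.
Proof.
have U_unitary : Up \is unitarymx.
  by apply: plaq_unitary => j; exact: expmx_unitary.
rewrite -opprB Re_trN mulrN normrN ger0_norm //.
by have := sqHS_ge0 (Up - 1%:M); rewrite -action_sqHS.
Qed.

(** The two extracted factors multiply to $(ir)^2=-r^2$, which is real, so the imaginary part passes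
    through; hence the minus sign. *)
Lemma Im_tr_plaq_remainder (r : R) (B : 'I_4 -> 'M[R[i]]_N) : r != 0 ->
  (forall j, LL j = ('i%C * r%:C) *: B j) ->
  complex.Im (\tr (Up - 1%:M)) =
  complex.Im (\tr (circ LL)) - r ^+ 2 * complex.Im (\tr (remainder B LL)).
Proof.
move=> r0 LE; have c0 : 'i%C * r%:C != 0 :> R[i].
  by apply/eqP => /(congr1 (@complex.Im R)) /=; rewrite !mul0r mul1r add0r; apply/eqP.
rewrite plaq_remainder (remainder_scale LL_anti c0 LE) mxtraceD mxtraceZ ImD ImM.
by congr (_ + _); rewrite /=; move: (complex.Re _) (complex.Im _) => u v; ring.
Qed.

End PlaquetteIdentities.

Section CircFields.
Variables (R : realType) (N : nat) (theta : 'I_(N ^ 2) -> 'M[R[i]]_N).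
Hypothesis theta_basis : selfadjoint_basis theta.

Lemma circZ (k : R[i]) (A : 'I_4 -> 'M[R[i]]_N) :
  circ (fun j => k *: A j) = k *: circ A.
Proof. by rewrite /circ -scalerDr -!scalerBr. Qed.

Lemma Im_tr_selfadj (y : 'I_(N ^ 2) -> R) : complex.Im (\tr (selfadj theta y)) = 0.
Proof.
have E : \tr ((selfadj theta y)^t*) = ((\tr (selfadj theta y))^*)%C.
  by rewrite /mxtrace rmorph_sum; apply: eq_bigr => i _; rewrite adjmxE.
by move: E; rewrite selfadj_adj // => /(congr1 (@complex.Im R)); rewrite ImJ; lra.
Qed.

Lemma tr_circ_real (y : 'I_4 -> 'I_(N ^ 2) -> R) :
  \tr (circ (fun j => selfadj theta (y j))) =
  (complex.Re (\tr (circ (fun j => selfadj theta (y j)))))%:C.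
Proof.
apply: complex_eqP => //=; rewrite /circ !mxtraceD !raddfN /=.
by rewrite !ImD !ImN !Im_tr_selfadj oppr0 !addr0.
Qed.

Lemma Im_tr_circ_ilie (c : R) (y : 'I_4 -> 'I_(N ^ 2) -> R) :
  complex.Im (\tr (circ (fun j => ilie theta c (y j)))) =
  c * complex.Re (\tr (circ (fun j => selfadj theta (y j)))).
Proof.
rewrite (circZ ('i%C * c%:C)) mxtraceZ tr_circ_real /=; move: (complex.Re _) => u.
by ring.
Qed.

Lemma entire_Im_tr_plaq (L : 'I_4 -> 'M[R[i]]_N) :
  entire (fun g => complex.Im (\tr (plaq (flow L g) - 1%:M))).
Proof.
by have [] := entire_mx_tr (entire_mxB (entire_plaq L) (entire_mx_cst 1%:M)).
Qed.

End CircFields.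

Section TotalAction.
Variables (R : realType) (N d L : nat) (theta : 'I_(N ^ 2) -> 'M[R[i]]_N).
Hypotheses (N_gt0 : (0 < N)%N) (theta_basis : selfadjoint_basis theta).

Lemma total_action_le (bc : boundary) (S : {set bond d L}) (U : bond d L -> 'M[R[i]]_N)
    (x : bond d L -> 'I_(N ^ 2) -> R) :
  (forall b, b \in S -> U b = expmx (ilie theta 1 (x b))) ->
  \sum_(p in plaquettes bc) action (plaq (fun j => retain S U (plaq_bond p j))) <=
  2 * (d%:R - 1) * C_plaq R N ^+ 2 * \sum_(b in S) sqnorm (x b).
Proof.
(* Extension by zero lets the count over all bonds charge only the retained ones. *)
move=> hU; pose f b := if b \in S then C_plaq R N ^+ 2 * sqnorm (x b) else 0.
have f_ge0 b : 0 <= f b.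
  by rewrite /f; case: ifP => // _; rewrite mulr_ge0 ?sqr_ge0 ?sqnorm_ge0.
have -> : 2 * (d%:R - 1) * C_plaq R N ^+ 2 * \sum_(b in S) sqnorm (x b) =
    2 * (d%:R - 1) * \sum_b f b.
  by rewrite /f -big_mkcond /= -mulr_sumr !mulrA.
apply: le_trans (sum_plaq_bond bc f_ge0); apply: ler_sum => p _.
apply: le_trans (action_retain_le theta_basis (plaq_bond p) hU) _.
rewrite /f -big_mkcond /= -mulr_sumr -mulr_sumr expr1n mul1r.
apply: ler_wpM2r; first by apply: sumr_ge0 => j _; exact: sqnorm_ge0.
rewrite sqr_C_plaq -natrM ler_nat.
apply: leq_trans (max_card _) _; rewrite card_ord.
by rewrite -[X in (X <= _)%N]muln1 leq_mul2l.
Qed.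

End TotalAction.

Local Close Scope classical_set_scope.

Unset Implicit Arguments.
Set Strict Implicit.
Set Printing Implicit Defensive.

Theorem lemma2 (R : realType) (N d L : nat) (a : R)
    (theta : 'I_(N ^ 2) -> 'M[R[i]]_N)
    (hN : (0 < N)%N) (hd : d \in [:: 2; 3; 4]%N)
    (hL : (0 < L)%N) (hLeven : ~~ odd L)
    (ha : 0 < a <= 1) (htheta : selfadjoint_basis theta) :
  (* (1) *)
  (forall x : 'I_4 -> 'I_(N ^ 2) -> R,
    let LL := fun j => ilie theta 1 (x j) in
    let Up := fun delta => plaq (flow LL delta) in
    let M := fun j delta => plaqM j LL (flow LL delta) in
    let dM := fun j delta => plaqdM j LL (flow LL delta) in
    [/\ (forall j alpha, (x j alpha)%:C = - 'i%C * \tr (theta alpha *m LL j)),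
        (forall j, norm_op (LL j) <= norm_HS (LL j) /\
                   norm_HS (LL j) = Num.sqrt (sqnorm (x j))),
        (forall j delta, 0 <= delta <= 1 ->
          [/\ is_derive_mx (M j) delta (dM j delta),
              integrable_mx (dM j) 0 delta,
              integrable_mx (M j) 0 1
            & integrable_mx (fun t => LL j + integral_mx (dM j) 0 t) 0 1]),
        Up 1 - 1%:M = rep1 LL
      & Up 1 - 1%:M = rep2 LL]) /\
  (* (2), the plaquette action *)
  (C_plaq R N ^+ 2 = 4 * N%:R /\
   forall x : 'I_4 -> 'I_(N ^ 2) -> R,
    let LL := fun j => ilie theta 1 (x j) in
    let U := fun j => expmx (LL j) in
    let Up := plaq U in
    [/\ (forall j, complex.Re (\tr (LL j)) = 0),
        action Up = - (2 * complex.Re (\tr (remainder LL LL))),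
        action Up = norm_HS (Up - 1%:M) ^+ 2 /\
        action Up = `|2 * complex.Re (\tr (Up - 1%:M))|,
        action Up <= C_plaq R N ^+ 2 * \sum_j sqnorm (x j)
      & forall S : {set 'I_4}, (1 <= #|S| <= 3)%N ->
          action (plaq (retain S U)) <=
            #|S|%:R * N%:R * \sum_(j in S) sqnorm (x j)]) /\
  (* (2), the physical parametrization *)
  (forall Au : 'I_4 -> 'I_(N ^ 2) -> R,
    let U := fun g j => expmx (ilie theta (g * a) (Au j)) in
    [/\ (forall g, 0 < g -> energy d a g (plaq (U g)) <=
          C_plaq R N ^+ 2 * a `^ (d%:R - 2) * \sum_j sqnorm (Au j)),
        (forall g (S : {set 'I_4}), 0 < g -> (1 <= #|S| <= 3)%N ->
          energy d a g (plaq (retain S (U g))) <=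
            #|S|%:R * N%:R * a `^ (d%:R - 2) * \sum_(j in S) sqnorm (Au j))
      & exists E : R -> R,
          [/\ (forall g, 0 < g -> E (g ^+ 2) = energy d a g (plaq (U g))),
              regular_in_g2 E
            & forall s, 0 <= s -> E s <=
                C_plaq R N ^+ 2 * a `^ (d%:R - 2) * \sum_j sqnorm (Au j)]]) /\
  (* (2), the scaled parametrization *)
  (forall A : 'I_4 -> 'I_(N ^ 2) -> R,
    let U := fun g j => expmx (ilie theta (g * a `^ ((4 - d%:R) / 2)) (A j)) in
    [/\ (forall g, 0 < g -> energy d a g (plaq (U g)) <=
          C_plaq R N ^+ 2 * \sum_j sqnorm (A j)),
        (forall g (S : {set 'I_4}), 0 < g -> (1 <= #|S| <= 3)%N ->
          energy d a g (plaq (retain S (U g))) <=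
            #|S|%:R * N%:R * \sum_(j in S) sqnorm (A j))
      & exists E : R -> R,
          [/\ (forall g, 0 < g -> E (g ^+ 2) = energy d a g (plaq (U g))),
              regular_in_g2 E
            & forall s, 0 <= s -> E s <=
                C_plaq R N ^+ 2 * \sum_j sqnorm (A j)]]) /\
  (* (3) *)
  (forall (bc : boundary) (S : {set bond d L}) (U : bond d L -> 'M[R[i]]_N)
      (lam : bond d L -> 'I_N -> R) (x : bond d L -> 'I_(N ^ 2) -> R),
    retained_bonds bc S ->
    (forall b, b \in S -> U b \is unitarymx /\
                          angular_coordinates theta (U b) (lam b) (x b)) ->
    \sum_(p in plaquettes bc)
        action (plaq (fun j => retain S U (plaq_bond p j))) <=
      2 * (d%:R - 1) * C_plaq R N ^+ 2 * \sum_(b in S) sqnorm (x b) /\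
    2 * (d%:R - 1) * C_plaq R N ^+ 2 * \sum_(b in S) sqnorm (x b) =
      2 * (d%:R - 1) * C_plaq R N ^+ 2 * \sum_(b in S) sqnorm (lam b)) /\
  (* (4) *)
  (forall (bc : boundary) (x : site d L) (mu nu : 'I_d)
      (Au : bond d L -> 'I_(N ^ 2) -> R),
    (x, mu, nu) \in plaquettes bc ->
    let p := (x, mu, nu) in
    let A := fun b alpha => a `^ ((d%:R - 2) / 2) * Au b alpha in
    let Fu := fun b => selfadj theta (Au b) in
    let F := fun b => selfadj theta (A b) in
    let pFu := fun j => Fu (plaq_bond p j) in
    let pF := fun j => F (plaq_bond p j) in
    let LL := fun g j => ilie theta (g * a) (Au (plaq_bond p j)) in
    let Up := fun g => plaq (fun j => expmx (LL g j)) in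
    [/\ \tr (circ pFu) = \tr (ldiff Fu mu nu x - ldiff Fu nu mu x),
        \tr (circ pF) = \tr (ldiff F mu nu x - ldiff F nu mu x),
        (forall g, 0 < g ->
          [/\ tr_Fu a g (Up g) = (a ^+ 2 * g)^-1 * complex.Im (\tr (rep1 (LL g))),
              tr_Fu a g (Up g) = (a ^+ 2 * g)^-1 * complex.Im (\tr (rep2 (LL g))),
              ((a ^+ 2 * g)^-1 * complex.Im (\tr (circ (LL g))))%:C =
                (a^-1)%:C * \tr (circ pFu),
              ((a ^+ 2 * g)^-1 * complex.Im (\tr (circ (LL g))))%:C =
                (a `^ (- (d%:R / 2)))%:C * \tr (circ pF)
            & tr_Fu a g (Up g) =
                (a ^+ 2 * g)^-1 * complex.Im (\tr (circ (LL g)))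
                - g * complex.Im (\tr (remainder pFu (LL g)))]),
        (forall g, 0 < g ->
          [/\ tr_F d a g (Up g) =
                a `^ (d%:R / 2) * ((a ^+ 2 * g)^-1 * complex.Im (\tr (rep1 (LL g)))),
              tr_F d a g (Up g) =
                a `^ (d%:R / 2) * ((a ^+ 2 * g)^-1 * complex.Im (\tr (rep2 (LL g)))),
              (a `^ (d%:R / 2) *
                ((a ^+ 2 * g)^-1 * complex.Im (\tr (circ (LL g)))))%:C =
                \tr (circ pF)
            & tr_F d a g (Up g) =
                a `^ (d%:R / 2) * ((a ^+ 2 * g)^-1 * complex.Im (\tr (circ (LL g))))
                - g * a `^ ((4 - d%:R) / 2) *
                  complex.Im (\tr (remainder pF (LL g)))])
      & (exists f : R -> R, regular_in_g f /\
          forall g, 0 < g -> f g = tr_Fu a g (Up g)) /\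
        (exists f : R -> R, regular_in_g f /\
          forall g, 0 < g -> f g = tr_F d a g (Up g))]).
Proof.
have a0 : 0 < a by case/andP: ha.
have an0 : a != 0 by rewrite gt_eqF.
have powD (u v : R) : a `^ (u + v) = a `^ u * a `^ v.
  by rewrite powRD // an0 implybT.
have pow2 : a ^+ 2 = a `^ 2 by rewrite powR_mulrn // ltW.
have anti c y : (ilie theta c y)^t* = - ilie theta c y by exact: ilie_anti.
split; [|split; [|split; [|split; [|split]]]].
- move=> x LL Up M dM.
  have LLa j : (LL j)^t* = - LL j by exact: anti.
  split.
  + by move=> j alpha; exact: coordE.
  + move=> j; split; first exact: norm_op_le_HS.
    by rewrite /norm_HS -/(sqHS (LL j)) sqHS_ilie // expr1n mul1r.
  + move=> j delta /andP[d0 _]; split.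
    * exact: is_derive_plaqM.
    * by apply: integrable_mx_entire; exact: entire_plaqdM.
    * by apply: integrable_mx_entire; exact: entire_plaqM.
    (* On $[0,1]$ the integrand coincides with $M_j$, which is continuous. *)
    apply: (eq_integrable_mx (F := fun t => plaqM j LL (flow LL t))) => [t /andP[t0 _]|].
      by symmetry; exact: add_integral_plaqdM.
    by apply: integrable_mx_entire; exact: entire_plaqM.
  + exact: rep1E.
  + by rewrite rep2E //; exact: rep1E.
- split; first exact: sqr_C_plaq.
  move=> x LL U Up.
  have LLa j : (LL j)^t* = - LL j by exact: anti.
  have one : (1 * 1 : R) = 1 by rewrite mulr1.
  split.
  + by move=> j; apply: Re_tr_antiadj.
  + exact: action_remainder.
  + split; last exact: action_norm.
    rewrite sqr_norm_HS action_sqHS //; apply: plaq_unitary => j.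
    exact: expmx_unitary.
  + have := action_plaq_ilie_le hN htheta 1 x 1.
    by rewrite one expr1n mul1r.
  + move=> S _; have := action_plaq_retain_le hN htheta 1 x 1 S.
    by rewrite one expr1n mul1r.
- move=> Au U; apply: plaquette_energy => //.
  by rewrite pow2 -powD; congr (_ `^ _); ring.
- move=> A U.
  have [|h1 h2 [E [E1 E2 E3]]] :=
    @plaquette_energy R N d a theta hN htheta (a `^ ((4 - d%:R) / 2)) A 1.
    by rewrite expr2 -!powD -[RHS](powRr0 a); congr (_ `^ _); field.
  split.
  + by move=> g /h1; rewrite mulr1.
  + by move=> g S g0 /(h2 _ _ g0); rewrite mulr1.
  + by exists E; split => // s /E3; rewrite mulr1.
- move=> bc S U lam x _ hS.
  split.
    by apply: (total_action_le hN htheta) => b /hS[_ []].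
  congr (_ * _); apply: eq_bigr => b /hS[_ [_ _ cp _]].
  exact: sqnorm_char_poly cp.
- move=> bc x mu nu Au _ p A Fu F pFu pF LL Up.
  have LLa g j : (LL g j)^t* = - LL g j by exact: anti.
  have circE (H : bond d L -> 'M[R[i]]_N) :
      circ (fun j => H (plaq_bond p j)) = ldiff H mu nu x - ldiff H nu mu x.
    rewrite /circ /ldiff /=.
    by apply/matrixP => i j; rewrite !mxE; ring.
  pose k := a `^ ((d%:R - 2) / 2).
  have k0 : k != 0 by rewrite gt_eqF // powR_gt0.
  have pFE j : pF j = k%:C *: pFu j by exact: selfadj_scale.
  have LLFu g j : LL g j = ('i%C * (g * a)%:C) *: pFu j by [].
  (* In scaled fields the exponent carries $ga/k=ga^{(4-d)/2}$. *)
  have LLF g j : LL g j = ('i%C * (g * a / k)%:C) *: pF j.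
    by rewrite pFE scalerA -mulrA -rmorphM /= divfK.
  have kE : a^-1 = a `^ (- (d%:R / 2)) * k.
    by rewrite -powD -[LHS](powR_inv1 (ltW a0)); congr (_ `^ _); field.
  have kE2 : a `^ (d%:R / 2) / k ^+ 2 = a `^ ((4 - d%:R) / 2).
    apply: (mulIf (x := k ^+ 2)); first by rewrite expf_neq0.
    by rewrite divfK ?expf_neq0 // expr2 -!powD; congr (_ `^ _); field.
  have circF : \tr (circ pF) = k%:C * \tr (circ pFu).
    have -> : pF = (fun j => k%:C *: pFu j) by apply/funext.
    by rewrite circZ mxtraceZ.
  (* The prefactor $(a^2g)^{-1}$ times $ga$ leaves $a^{-1}$ for the unscaled fields; rewritten in
     the scaled ones this is $a^{-d/2}$. *)
  have isolated g : 0 < g -> ((a ^+ 2 * g)^-1 * complex.Im (\tr (circ (LL g))))%:C =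
      (a^-1)%:C * \tr (circ pFu).
    move=> g0; have gn0 : g != 0 by rewrite gt_eqF.
    have -> : \tr (circ pFu) = (complex.Re (\tr (circ pFu)))%:C := tr_circ_real htheta _.
    rewrite (Im_tr_circ_ilie htheta) -rmorphM; congr (_%:C).
    by rewrite -/(circ pFu); move: (complex.Re _) => u; field; rewrite an0 gn0.
  have isolatedF g : 0 < g -> ((a ^+ 2 * g)^-1 * complex.Im (\tr (circ (LL g))))%:C =
      (a `^ (- (d%:R / 2)))%:C * \tr (circ pF).
    by move=> g0; rewrite isolated // circF kE rmorphM mulrA.
  split.
  + by rewrite circE.
  + by rewrite circE.
  + move=> g g0; have gn0 : g != 0 by rewrite gt_eqF.
    split; [by rewrite /tr_Fu plaq_rep1|by rewrite /tr_Fu plaq_rep2|exact: isolated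
      |exact: isolatedF|].
    rewrite /tr_Fu (Im_tr_plaq_remainder (LLa g) _ (LLFu g)) ?mulf_neq0 //.
    rewrite mulrBr; congr (_ - _); move: (complex.Im _) => u.
    by field; rewrite an0 gn0.
  + move=> g g0; have gn0 : g != 0 by rewrite gt_eqF.
    split; [by rewrite /tr_F /tr_Fu plaq_rep1|by rewrite /tr_F /tr_Fu plaq_rep2| |].
      rewrite rmorphM /= isolatedF // mulrA -rmorphM -powD subrr powRr0 mul1r.
      by [].
    rewrite /tr_F /tr_Fu (Im_tr_plaq_remainder (LLa g) _ (LLF g)); last first.
      by rewrite !mulf_neq0 // invr_neq0.
    rewrite !mulrBr; congr (_ - _); rewrite -kE2; move: (complex.Im _) (_ `^ _) => u v.
    by field; rewrite an0 gn0 k0.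
  (* These are the generators at $g=1$. At flow time $0$ the plaquette variable is the identity, so
     the numerator vanishes and the division by $g$ stays entire. *)
  + pose L0 j := ilie theta a (Au (plaq_bond p j)).
    have UpE g : Up g = plaq (flow L0 g) by rewrite /Up /LL flow_ilie.
    have h0 : complex.Im (\tr (plaq (flow L0 0) - 1%:M)) = 0.
      by rewrite plaq0 subrr mxtrace0.
    have q := entire_quotient (entire_Im_tr_plaq L0) h0.
    split.
      have [f [rf fE]] := q (a ^+ 2)^-1; exists f; split=> [|g g0]; first by [].
      rewrite (fE _ g0) /tr_Fu UpE; move: (complex.Im _) => u.
      by field; rewrite an0 gt_eqF.
    have [f [rf fE]] := q (a `^ (d%:R / 2) * (a ^+ 2)^-1); exists f; split=> [|g g0]; first by [].
    rewrite (fE _ g0) /tr_F /tr_Fu UpE; move: (complex.Im _) (_ `^ _) => u v.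
    by field; rewrite an0 gt_eqF.
Qed.
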